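(* Let $D$ be a Young diagram with $|D|$ boxes and let $\Xi(t)$, $t\in I$, be a smooth one-parameter family of representations of the quiver $\mathfrak Q_D$ compatible with $D$. Then there exists a unique, up to a symplectic transformation, monotonically nondecreasing curve $\Lambda(t)$, $t\in I$, in the Lagrange Grassmannian of a $2|D|$-dimensional symplectic space with Young diagram $D$ such that the quiver of curvatures of $\Lambda(t)$ is isomorphic to $\Xi(t)$. If, in addition, all rows of $D$ have different lengths, then, given a tuple of smooth functions $\{\rho_{a,b}(t):(a,b)\in\Delta\times\Delta,\ (a,b)\text{ an essential pair}\}$ on $I$ with $\rho_{a,b}=\rho_{b,a}$, there exists a unique, up to a symplectic transformation, monotonically nondecreasing curve $\Lambda(t)$ in the Lagrange Grassmannian of a $2|D|$-dimensional symplectic space with Young diagram $D$ such that for every essential pair $(a,b)$ and every $t$ its $(a,b)$-curvature at $t$ coincides with $\rho_{a,b}(t)$ (i.e. $R_t(a,b)=\rho_{a,b}(t)$ for all essential pairs, for the normal mapping $R_t$ associated with some normal moving frame of $\Lambda$).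
   Context: **Curves.** $W$ is a real $2m$-dimensional vector space with symplectic form $\omega$; $L(W)$ is the set of Lagrangian subspaces; $\Lambda:I\to L(W)$ is a smooth curve on an interval $I$. $\mathfrak S(\Lambda)$ is the set of smooth curves $\ell$ in $W$ with $\ell(t)\in\Lambda(t)$ for all $t$, and $\Lambda^{(i)}(\tau)=\mathrm{span}\{\frac{d^j}{d\tau^j}\ell(\tau):\ell\in\mathfrak S(\Lambda),\,0\le j\le i\}$. Standing assumptions: $\dim\Lambda^{(i)}(t)$ is independent of $t$ for every $i$, and $\Lambda^{(p)}(t)=W$ for some integer $p$. The velocity $\dot\Lambda(t)$ is identified with the quadratic form $v\mapsto\omega(\ell'(t),\ell(t))$ on $\Lambda(t)$, where $\ell\in\mathfrak S(\Lambda)$, $\ell(t)=v$. The curve is monotonically nondecreasing if $\dot\Lambda(t)$ is nonnegative definite for all $t$. **Diagrams.** The Young diagram $D$ of the curve has $\dim\Lambda^{(i)}-\dim\Lambda^{(i-1)}$ boxes in its $i$th column ($\Lambda^{(0)}=\Lambda$). Any Young diagram $D$ is uniquely a union of $d$ rectangular diagrams $D_i$ ($r_i$ rows, $p_i$ columns), stacked from top to bottom, with $p_1>\dots>p_d$. The reduction $\Delta$ of $D$ has $d$ rows, the $i$th of length $p_i$. Boxes of $\Delta$ are superboxes, rows are levels; $\Upsilon_i$ is the $i$th level. The $j$th superbox of the $i$th level corresponds to the $j$th column of $D_i$ and has size $r_i$. $a_i$, $\sigma_i$ are the first and last superboxes of $\Upsilon_i$; the $\sigma_i$ are special, $\mathcal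 S=\{\sigma_1,\dots,\sigma_d\}$; $\mathcal F_1$ is the first column of $\Delta$; $l,r$ are left and right shifts by one superbox. (If all rows of $D$ have different lengths, all $r_i=1$ and $\Delta=D$.) **Normal mappings.** $R:\Delta\times\Delta\to\{\text{real matrices}\}$ is compatible with $D$ if $R(a,b)$ has size $s_2\times s_1$ whenever $a,b$ have sizes $s_1,s_2$; symmetric if $R(b,a)=R(a,b)^T$. For $1\le j<i\le d$ consider the tuple of pairs $$(a_j,a_i),(a_j,r(a_i)),(r(a_j),r(a_i)),(r(a_j),r^2(a_i)),\dots,(r^{p_i-1}(a_j),r^{p_i-1}(a_i)),(r^{p_i}(a_j),r^{p_i-1}(a_i)),\dots,(r^{p_j-1}(a_j),r^{p_i-1}(a_i)).\quad(\ast)$$ (Alternately shift the second and the first entry until the second entry is special; then shift only the first.) A symmetric compatible $R$ is quasi-normal if (1) among all $R(a,b)$ with $b$ not higher than $a$, the only possibly nonzero ones are $R(a,a)$, $R(a,r(a))$ and $R(r(a),a)$ for nonspecial $a$, and $R(a,b)$ for pairs appearing in the tuples $(\ast)$, $1\le j<i\le d$; (2) $R(a,r(a))$ is antisymmetric for every nonspecial $a$. It is normal if in addition, for all $j<i$, the matrices corresponding to the first $p_j-p_i-1$ pairs of $(\ast)$ vanish. A pair $(a,b)\in\Delta\times\Delta$ is essential if $R(a,b)$ is not necessarily zero for a normal mapping, i.e. $R(a,b)\ne0$ for some normal mapping $R$. **Frames.** A Darboux frame $(\{e_\alpha\}_{\alpha\in D},\{f_\alpha\}_{\alpha\in D})$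 satisfies $\omega(e_\alpha,e_\beta)=\omega(f_\alpha,f_\beta)=\omega(f_\alpha,e_\beta)-\delta_{\alpha,\beta}=0$. For a superbox $a$ with corresponding boxes $\alpha_1,\dots,\alpha_s$ of $D$ (top to bottom), $E_a=(e_{\alpha_1},\dots,e_{\alpha_s})$, $F_a=(f_{\alpha_1},\dots,f_{\alpha_s})$ (rows of vectors). A smooth moving Darboux frame is a normal moving frame of a monotonically nondecreasing curve $\Lambda$ with Young diagram $D$ if $\Lambda(t)=\mathrm{span}\{E_a(t)\}_{a\in\Delta}$ and there are normal mappings $R_t$ (called associated with the frame) with $E_a'=E_{l(a)}$ for $a\notin\mathcal F_1$; $E_a'=F_a$ for $a\in\mathcal F_1$; $F_a'=\sum_bE_bR_t(a,b)-F_{r(a)}$ for $a\notin\mathcal S$; $F_a'=\sum_bE_bR_t(a,b)$ for $a\in\mathcal S$. Known fact: normal moving frames exist, and any two are related by $\widetilde E_a=E_aU_i$, $\widetilde F_a=F_aU_i$ ($a\in\Upsilon_i$) with constant $U_i\in O(r_i)$. **Curvatures and quivers.** $V_a(t)=\mathrm{span}\{E_a(t)\}$ with the Euclidean structure making $E_a(t)$ orthonormal does not depend on the normal frame. For an essential pair $(a,b)$ the $(a,b)$-curvature mapping $\mathfrak R_t(a,b):V_a(t)\to V_b(t)$ is the linear map with matrix $R_t(a,b)$ in the bases $E_a(t),E_b(t)$; it does not depend on the normal frame. For fixed $i$, all spaces $V_a(t)$, $a\in\Upsilon_i$, $t\in I$, are identified with a single Euclidean space $\mathcal X_i$ (by sending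 $E_{a}(t_1)$ to $E_{b}(t_2)$). The quiver $\mathfrak Q_D$ has the levels of $\Delta$ as vertices, and its arrows from $\Upsilon_i$ to $\Upsilon_j$ are the essential pairs $(a,b)\in\Upsilon_i\times\Upsilon_j$. A representation of $\mathfrak Q_D$ (a vector space for each vertex, a linear map for each arrow) is compatible with $D$ if the space at $\Upsilon_i$ is an $r_i$-dimensional Euclidean space and the maps $\mathcal R(a,b)$ satisfy $\mathcal R(a,b)^*=\mathcal R(b,a)$ and $\mathcal R(a,r(a))$ antisymmetric. One-parameter families of representations have fixed spaces (independent of $t$) and maps depending on $t$. The quiver of curvatures of $\Lambda$ is the family of compatible representations given by the spaces $\mathcal X_i$ and the maps $\mathfrak R_t(a,b)\in\mathrm{Hom}(\mathcal X_i,\mathcal X_j)$. Two families are isomorphic if there is a tuple of isometries, independent of $t$, between corresponding spaces conjugating all corresponding maps. If all sizes $r_i$ equal 1, the scalars $R_t(a,b)$ are called $(a,b)$-curvatures (normal frames are then unique up to signs $U_i=\pm1$). *)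

(* Defs.v *)
From HB Require Import structures.
From mathcomp Require Import all_boot all_order all_algebra sesquilinear.
From mathcomp Require Import all_classical all_reals all_analysis.

Set Implicit Arguments.
Unset Strict Implicit.
Unset Printing Implicit Defensive.

Import Order.TTheory GRing.Theory Num.Theory.
Import numFieldNormedType.Exports.

Local Open Scope classical_set_scope.
Local Open Scope ring_scope.

(* A Young diagram is given by the lengths of its rows, from top to bottom. *)
Record young_diagram := YoungDiagram {
  rows :> seq nat;
  rows_sorted : sorted geq rows;
  rows_gt0 : 0%N \notin rows }.

Section Diagram.
Variable D : young_diagram.

Definition nb_boxes : nat := sumn D.

(* Columns are numbered from 0. *)
Definition column_size (c : nat) : nat := count (fun p => c < p)%N D.

(* As the rows are sorted, [undup D] lists the distinct row lengths
   p_1 > ... > p_d; the i-th rectangle consists of all rows of length p_i. *)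
Definition depth : nat := size (undup D).
Definition level : finType := 'I_depth.
Definition level_length (i : level) : nat := nth 0%N (undup D) i.
Definition level_mult (i : level) : nat := count_mem (level_length i) D.

(* The reduced diagram, as the set of its boxes (level, column). *)
Definition superbox : finType := {i : level & 'I_(level_length i)}.
Definition superbox_col (a : superbox) : nat := tagged a.
Definition superbox_size (a : superbox) : nat := level_mult (tag a).

(* A box of D is the k-th box from the top in the column of the rectangle
   which corresponds to its superbox. *)
Definition box : finType := {a : superbox & 'I_(superbox_size a)}.
Definition mkbox (a : superbox) (k : 'I_(superbox_size a)) : box :=
  Tagged (fun a => 'I_(superbox_size a)) k.

Lemma level_length_gt0 (i : level) : (0 < level_length i)%N.
Proof.
rewrite lt0n; apply: contra (rows_gt0 D) => /eqP h.
by rewrite -mem_undup -h mem_nth.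
Qed.

Definition first_superbox (i : level) : superbox :=
  Tagged (fun i => 'I_(level_length i)) (Ordinal (level_length_gt0 i)).

Definition special (a : superbox) : bool :=
  (superbox_col a).+1 == level_length (tag a).
Definition in_first_column (a : superbox) : bool := superbox_col a == 0%N.

(* The shifts are made total by fixing the superboxes without right
   (resp. left) neighbour; both preserve the level definitionally. *)
Definition superbox_right (a : superbox) : superbox :=
  Tagged (fun i => 'I_(level_length i))
    (insubd (tagged a) (superbox_col a).+1).
Definition superbox_left (a : superbox) : superbox :=
  Tagged (fun i => 'I_(level_length i))
    (insubd (tagged a) (superbox_col a).-1).

(* For j < i: alternately shift the second and the first entry of (a_j, a_i),
   in this order, until the second one is special (the entries of rank
   0, ..., 2 p_i - 2), then shift the first entry only. *)
Definition shift_pairs (j i : level) : seq (superbox * superbox) :=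
  let aj := first_superbox j in
  let ai := first_superbox i in
  [seq (iter k./2 superbox_right aj, iter (uphalf k) superbox_right ai)
     | k <- iota 0 (2 * level_length i).-1] ++
  [seq (iter k superbox_right aj, iter (level_length i).-1 superbox_right ai)
     | k <- iota (level_length i) (level_length j - level_length i)].

Lemma card_box : #|box| = nb_boxes.
Proof.
have sg s : sumn s = (\sum_(x <- undup s) x * count_mem x s)%N.
  rewrite sumnE -big_undup_iterop_count.
  by apply: eq_bigr => x _; rewrite Monoid.iteropE iter_addn_0.
rewrite card_tagged sumnE big_map big_enum /=.
rewrite (eq_bigr (fun a : superbox => level_mult (tag a))); last first.
  by move=> a _; rewrite card_ord.
rewrite (eq_bigl (fun a : superbox => true && true)) //.
rewrite -(@sig_big_dep _ _ _ _ _ xpredT (fun=> xpredT)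
  (fun i _ => level_mult i)) /=.
rewrite /nb_boxes sg (big_nth 0%N) big_mkord.
apply: eq_bigr => i _; rewrite sum_nat_const card_ord.
by [].
Qed.

End Diagram.

Section NormalMappings.
Variables (R : realType) (D : young_diagram).

Definition compatible_mapping :=
  forall a b : superbox D, 'M[R]_(superbox_size b, superbox_size a).

Implicit Types Rm : compatible_mapping.

Definition symmetric_mapping Rm : Prop := forall a b, Rm b a = (Rm a b)^T.

(* Levels are numbered from top to bottom: b is not higher than a iff
   [tag a <= tag b]. *)
Definition quasi_normal Rm : Prop :=
  [/\ symmetric_mapping Rm,
      forall a b : superbox D, (tag a <= tag b)%N -> Rm a b <> 0 ->
        [\/ b = a,
            ~~ special a /\ b = superbox_right a,
            ~~ special b /\ a = superbox_right b
          | exists j i : level D,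
              (j < i)%N /\ (a, b) \in shift_pairs j i]
    & forall a, ~~ special a ->
        (Rm a (superbox_right a))^T = - Rm a (superbox_right a) :> 'M[R]_(superbox_size a)].

Definition normal_mapping Rm : Prop :=
  quasi_normal Rm /\
  forall j i : level D, (j < i)%N ->
    forall a b,
      (a, b) \in take (level_length j - level_length i - 1) (shift_pairs j i) ->
      Rm a b = 0.

Definition essential (a b : superbox D) : Prop :=
  exists2 Rm, normal_mapping Rm & Rm a b <> 0.

End NormalMappings.

Arguments essential R {D} a b.

Record quiver := Quiver {
  vertex : Type;
  arrow : Type;
  source : arrow -> vertex;
  target : arrow -> vertex }.

Record essential_pair (R : realType) (D : young_diagram) := EssentialPair {
  ep_source : superbox D;
  ep_target : superbox D;
  ep_essential : essential R ep_source ep_target }.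

Definition diagram_quiver (R : realType) (D : young_diagram) : quiver :=
  @Quiver (level D) (essential_pair R D)
    (fun x => tag (ep_source x)) (fun x => tag (ep_target x)).

Record euclidean_space (R : realType) := EuclideanSpace {
  carrier :> vectType R;
  inner : {dot carrier for idfun} }.

(* A one-parameter family of representations on Euclidean spaces: the spaces
   do not depend on the parameter. Only the parameters of the interval under
   consideration matter in the predicates below. *)
Record rep_family (R : realType) (Q : quiver) := RepFamily {
  rep_space : vertex Q -> euclidean_space R;
  rep_map : R -> forall x : arrow Q,
    'Hom(rep_space (source x), rep_space (target x)) }.

Definition iso_rep_family (R : realType) (Q : quiver) (I : set R)
    (X Y : rep_family R Q) : Prop :=
  exists phi : forall i : vertex Q, 'Hom(rep_space X i, rep_space Y i),
    (forall i, isometry (inner (rep_space Y i)) (inner (rep_space X i)) (phi i)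
       /\ bijective (phi i)) /\
    forall t, I t -> forall (x : arrow Q) v,
      phi (target x) (rep_map X t x v) = rep_map Y t x (phi (source x) v).

Section Compatible.
Variables (R : realType) (D : young_diagram) (I : set R).
Variable X : rep_family R (diagram_quiver R D).

Definition pair_map (t : R) (a b : superbox D) (h : essential R a b) :
    'Hom(rep_space X (tag a), rep_space X (tag b)) :=
  rep_map X t (EssentialPair h : arrow (diagram_quiver R D)).

Definition compatible_rep_family : Prop :=
  [/\ forall i : level D, \dim {: rep_space X i} = level_mult i,
      forall t, I t -> forall a b (h : essential R a b) (h' : essential R b a),
        forall v w, inner (rep_space X (tag b)) (pair_map t h v) w =
                    inner (rep_space X (tag a)) v (pair_map t h' w)
    & forall t, I t -> forall a (h : essential R a (superbox_right a)),
        ~~ special a ->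
        forall v w : rep_space X (tag a),
          inner (rep_space X (tag a)) (pair_map t h v) w =
          - inner (rep_space X (tag a)) v (pair_map t h w)].

End Compatible.

Section Smooth.
Variables (R : realType) (W : vectType R).

(* Derivatives are taken along I, hence one-sided at the endpoints of I which
   belong to I; vector-valued functions are differentiated weakly, i.e. after
   composition with any linear functional. *)
Definition has_deriv_on (I : set R) (f g : R -> W) : Prop :=
  forall (phi : {scalar W}) (t : R), I t ->
    (fun s => (phi (f s) - phi (f t)) / (s - t)) @ within I t^' --> phi (g t).

(* [g n] is the n-th derivative of [f] on I. *)
Definition derivatives_on (I : set R) (f : R -> W) (g : nat -> R -> W) : Prop :=
  (forall t, I t -> g 0%N t = f t) /\
  forall n, has_deriv_on I (g n) (g n.+1).

Definition smooth_on (I : set R) (f : R -> W) : Prop :=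
  exists g, derivatives_on I f g.

Definition spans (A : set W) (U : {vspace W}) : Prop :=
  (forall v, A v -> v \in U) /\
  forall U' : {vspace W}, (forall v, A v -> v \in U') -> (U <= U')%VS.

(* The subspace spanned by A always exists: see [set_spanP]. *)
Definition set_span (A : set W) : {vspace W} := xget 0%VS [set U | spans A U].

Lemma set_spanP (A : set W) : spans A (set_span A).
Proof.
suff [U hU] : exists U, spans A U.
  by apply: (@xgetPex _ 0%VS [set U | spans A U]); exists U.
pose P n := `[< exists bs : seq W,
  (forall x, x \in bs -> A x) /\ \dim <<bs>> = n >].
have P0 : exists n, P n.
  by exists 0%N; apply/asboolP; exists [::]; split => //; rewrite span_nil dimv0.
have Pub n : P n -> (n <= \dim {:W})%N.
  by move=> /asboolP[bs [_ <-]]; rewrite dimvS ?subvf.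
have [m /asboolP[bs [sA dims]] mmax] := ex_maxnP P0 Pub.
exists <<bs>>%VS; split.
  move=> v Av; have sub : (<<bs>> <= <<v :: bs>>)%VS by rewrite span_cons addvSr.
  suff /eqP -> : (<<bs>> == <<v :: bs>>)%VS by rewrite memv_span ?mem_head.
  rewrite eqEdim sub dims mmax //; apply/asboolP; exists (v :: bs); split => //.
  by move=> x; rewrite inE => /predU1P[->|/sA].
by move=> U' hU'; apply/span_subvP => x /sA /hU'.
Qed.

End Smooth.

Section Curves.
Variables (R : realType) (D : young_diagram) (I : set R).
Variables (W : vectType R) (omega : {skew_symmetric W}).

Definition lagrangian (U : {vspace W}) : Prop :=
  (forall v w, v \in U -> w \in U -> omega v w = 0) /\
  (2 * \dim U)%N = \dim {:W}.

Implicit Type L : R -> {vspace W}.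

(* Smoothness into the Grassmannian, seen as the quotient of the manifold of
   frames by the linear group: local smooth lifts to frames. *)
Definition smooth_subspaces L : Prop :=
  forall t0, I t0 -> exists2 e : R, 0 < e &
    exists n, exists b : 'I_n -> R -> W,
      (forall k, smooth_on (I `&` ball t0 e) (b k)) /\
      forall t, (I `&` ball t0 e) t ->
        basis_of (L t) [seq b k t | k <- enum 'I_n].

Definition section L (l : R -> W) : Prop :=
  smooth_on I l /\ forall t, I t -> l t \in L t.

Definition extension L (i : nat) (t : R) : {vspace W} :=
  set_span [set v | exists l, section L l /\
     exists g, derivatives_on I l g /\ exists2 j, (j <= i)%N & v = g j t].

Definition lagrangian_curve L : Prop :=
  [/\ forall t, I t -> lagrangian (L t),
      smooth_subspaces L,
      forall i s t, I s -> I t ->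
        \dim (extension L i s) = \dim (extension L i t)
    & exists p, forall t, I t -> extension L p t = fullv].

(* The graph of the velocity of L at t, a quadratic form on L t. *)
Definition velocity_value L (t : R) (v : W) (q : R) : Prop :=
  exists l g, [/\ section L l, derivatives_on I l g, l t = v
                & q = omega (g 1%N t) (l t)].

Definition nondecreasing_curve L : Prop :=
  forall t, I t -> forall v q, v \in L t -> velocity_value L t v q -> 0 <= q.

Definition has_young_diagram L : Prop :=
  forall i t, I t ->
    \dim (extension L i.+1 t) =
      (\dim (extension L i t) + column_size D i)%N.

Implicit Types (e f : box D -> R -> W) (Rt : R -> compatible_mapping R D).

Definition darboux_frame (e f : box D -> W) : Prop :=
  forall x y, [/\ omega (e x) (e y) = 0, omega (f x) (f y) = 0
                & omega (f x) (e y) = (x == y)%:R].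

Definition normal_frame L e f Rt : Prop :=
  [/\ forall x, smooth_on I (e x) /\ smooth_on I (f x),
      forall t, I t -> darboux_frame (e^~ t) (f^~ t),
      forall t, I t -> L t = <<[seq e x t | x <- enum (box D)]>>%VS,
      forall t, I t -> normal_mapping (Rt t)
    & forall (a : superbox D) (k : 'I_(superbox_size a)),
      let ER t := \sum_(b : superbox D) \sum_(m < superbox_size b)
                    Rt t a b m k *: e (mkbox m) t in
      [/\ ~~ in_first_column a ->
            has_deriv_on I (e (mkbox k)) (e (@mkbox D (superbox_left a) k)),
          in_first_column a ->
            has_deriv_on I (e (mkbox k)) (f (mkbox k)),
          ~~ special a ->
            has_deriv_on I (f (mkbox k))
              (fun t => ER t - f (@mkbox D (superbox_right a) k) t)
        & special a -> has_deriv_on I (f (mkbox k)) ER]].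

End Curves.

Section StandardEuclidean.
Variables (R : realType) (n : nat).

Definition std_inner (x y : 'cV[R]_n) : R := \sum_i x i 0 * y i 0.

Fact std_inner_bilinear : bilinear_for *%R (idfun \; *%R) std_inner.
Proof.
split=> u a x y; rewrite /std_inner /= mulr_sumr -big_split /=;
  by apply: eq_bigr => i _; rewrite !mxE ?mulrDl ?mulrDr mulrA // mulrCA mulrA.
Qed.
HB.instance Definition _ :=
  bilinear_isBilinear.Build _ _ _ _ _ _ std_inner std_inner_bilinear.

Fact std_inner_sym x y : std_inner x y = (-1) ^+ false * idfun (std_inner y x).
Proof.
by rewrite expr0 mul1r /=; apply: eq_bigr => i _; rewrite mulrC.
Qed.
HB.instance Definition _ :=
  isHermitianSesquilinear.Build _ _ false idfun std_inner std_inner_sym.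

Fact std_inner_gt0 x : x != 0 -> 0 < std_inner x x.
Proof.
move=> x0; rewrite lt_def; apply/andP; split; last first.
  by apply: sumr_ge0 => i _; rewrite -expr2 sqr_ge0.
apply: contra x0; rewrite /std_inner psumr_eq0; last first.
  by move=> i _; rewrite -expr2 sqr_ge0.
move=> /allP h; apply/eqP/matrixP => i j; rewrite ord1 mxE.
by have := h i (mem_index_enum _); rewrite /= mulf_eq0 orbb => /eqP.
Qed.
HB.instance Definition _ := isDotProduct.Build _ _ std_inner std_inner_gt0.

Definition std_euclidean : euclidean_space R :=
  @EuclideanSpace R 'cV[R]_n std_inner.

End StandardEuclidean.

Section Curvatures.
Variables (R : realType) (D : young_diagram) (W : vectType R).
Variables (e : box D -> R -> W) (Rt : R -> compatible_mapping R D).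

Definition frame_part (t : R) (a : superbox D) : (superbox_size a).-tuple W :=
  [tuple e (mkbox k) t | k < superbox_size a].

(* V_a(t), whose Euclidean structure makes [frame_part t a] orthonormal. *)
Definition frame_space (t : R) (a : superbox D) : {vspace W} :=
  <<frame_part t a>>%VS.

(* The spaces V_a(t), for a in the i-th level and t in I, are all identified
   with R^(r_i), by the mutually inverse isometries [from_model] and
   [to_model] which exchange [frame_part t a] and the standard basis. *)
Definition from_model (t : R) (a : superbox D)
    (x : 'cV[R]_(superbox_size a)) : W :=
  \sum_k x k 0 *: tnth (frame_part t a) k.
Definition to_model (t : R) (a : superbox D) (v : W) :
    'cV[R]_(superbox_size a) :=
  \col_k coord (frame_part t a) k v.

(* The curvature mapping from V_a(t) to V_b(t); only its values on V_a(t) are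
   meaningful. *)
Definition curvature_mapping (t : R) (a b : superbox D) (v : W) : W :=
  from_model t (Rt t a b *m to_model t a v).

Definition frame_curvature_quiver : rep_family R (diagram_quiver R D) :=
  @RepFamily R (diagram_quiver R D)
    (fun i => std_euclidean R (level_mult i))
    (fun t x => linfun (fun y : 'cV[R]_(superbox_size (ep_source x)) =>
       to_model t (ep_target x)
         (curvature_mapping t (ep_source x) (ep_target x) (from_model t y)))).

End Curvatures.

(* The quivers computed in the various normal moving frames of a curve are
   isomorphic to one another. *)
Definition curvature_quiver_of (R : realType) (D : young_diagram) (I : set R)
    (W : vectType R) (omega : {skew_symmetric W}) (L : R -> {vspace W})
    (X : rep_family R (diagram_quiver R D)) : Prop :=
  exists e f Rt, normal_frame I omega L e f Rt /\
    X = frame_curvature_quiver e Rt.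

Definition monotone_curve_with_diagram (R : realType) (D : young_diagram)
    (I : set R) (W : vectType R) (omega : {skew_symmetric W})
    (L : R -> {vspace W}) : Prop :=
  [/\ lagrangian_curve I omega L, nondecreasing_curve I omega L
    & has_young_diagram D I L].

Definition exists_unique_up_to_symplectic (R : realType) (I : set R) (W : vectType R)
    (omega : {skew_symmetric W}) (P : (R -> {vspace W}) -> Prop) : Prop :=
  (exists L, P L) /\
  forall L1 L2, P L1 -> P L2 ->
    exists S : 'End(W), isometry omega omega S /\
      forall t, I t -> L2 t = (S @: L1 t)%VS.

(* Main.v *)
(* The structure equations of a normal moving frame form a linear ODE whose
   coefficients are the entries of the normal mappings. For two solutions (e, f)
   and (e', f') of the same equations, the symmetry of the mappings makes the
   operator v |-> sum_x omega(f_x, v) e'_x - omega(e_x, v) f'_x constant in time.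
   When both frames are Darboux this operator is a fixed symplectic map carrying
   one curve to the other, whence uniqueness, after rotating one of the frames
   by the isometries relating the two quivers. When the frames coincide and are
   Darboux at one time, the operator is the identity, which amounts to being
   Darboux at all times; so existence reduces to that of solutions of linear
   ODEs, where the normal mappings are the matrices of the given representations
   in orthonormal bases, extended by 0 to the pairs which are not essential.

   In the curve spanned by such a frame, the i-th extension is the space of the
   v such that omega(v, e_x) = 0 for all boxes x in the columns numbered from i:
   differentiating omega(g, e_x) = 0 moves x by one column. *)

Require Import Defs.
From HB Require Import structures.
From mathcomp Require Import all_boot all_order all_algebra sesquilinear.
From mathcomp Require Import all_classical all_reals all_analysis.
From mathcomp Require Import ring lra zify.

Set Implicit Arguments.
Unset Strict Implicit.
Unset Printing Implicit Defensive.

Import Order.TTheory GRing.Theory Num.Theory.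
Import numFieldNormedType.Exports.

Local Open Scope classical_set_scope.
Local Open Scope ring_scope.

(** * Differentiation and primitives on an interval *)

(** The interval may be open, half-open or unbounded, so the coefficients of the equations are
    bounded on compact subintervals only. The Picard series is therefore dominated by an exponential
    series on a compact subinterval that contains the initial time and a neighbourhood in [I] of the
    current point, and limits are differentiated under locally uniform convergence. As derivatives
    are taken along [I], the estimates are stated as inequalities valid at interior points and
    endpoints alike.

    The structure equations form a Hamiltonian system: the curvature terms cancel because the
    mappings are symmetric, the shift terms because the left and right shifts are inverse to each
    other. This single cancellation serves both existence and uniqueness. The rotations depend on
    the level only and not on time, hence they commute with the shifts and with differentiation.

    The tuples of pairs in the definition of normality are never enumerated: an essential pair
    carries a normal mapping that is nonzero there, and this witness shows that the pair is an
    allowed one. *)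

Section DerivativesOnIntervals.
Variables (R : realType) (I : set R).
Hypotheses (hI : is_interval I) (hI2 : exists s t : R, [/\ I s, I t & s < t]).

Definition deriv_on (f g : R -> R) : Prop :=
  forall t, I t ->
    (fun s => (f s - f t) / (s - t)) @ within I t^' --> g t.

Definition cont_on (f : R -> R) : Prop :=
  forall t, I t -> f @ within I (nbhs t) --> f t.

(** Clearing the denominator makes the point s = t harmless, so that estimates need not exclude
    it. *)
Lemma deriv_onP f g : deriv_on f g <->
  forall t, I t -> forall eps, 0 < eps -> exists2 d, 0 < d &
    forall s, I s -> `|s - t| < d ->
      `|f s - f t - (s - t) * g t| <= eps * `|s - t|.
Proof.
split=> h t It.
  move=> eps e0; move/cvgrPdist_le: (h t It) => /(_ eps e0).
  rewrite /within /= nearE => /nbhs_ballP[d /= d0 hd].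
  exists d => // s Is st; have [->|nst] := eqVneq s t.
    by rewrite !subrr mul0r subrr normr0 mulr0.
  have := hd s; rewrite /ball /= distrC => /(_ st nst Is).
  have nst0 : s - t != 0 by rewrite subr_eq0.
  rewrite distrC -(ler_pM2r (x := `|s - t|)) ?normr_gt0 // -normrM.
  by rewrite mulrBl divfK // [g t * _]mulrC.
apply/cvgrPdist_le => eps e0; have [d d0 hd] := h t It eps e0.
rewrite /within /= nearE; apply/nbhs_ballP; exists d => // s.
rewrite /ball /= distrC => st nst Is.
have nst0 : s - t != 0 by rewrite subr_eq0.
rewrite distrC -(ler_pM2r (x := `|s - t|)) ?normr_gt0 // -normrM.
by rewrite mulrBl divfK // [g t * _]mulrC; exact: hd.
Qed.

Lemma cont_onP f : cont_on f <->
  forall t, I t -> forall eps, 0 < eps -> exists2 d, 0 < d &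
    forall s, I s -> `|s - t| < d -> `|f s - f t| <= eps.
Proof.
split=> h t It.
  move=> eps e0; move/cvgrPdist_le: (h t It) => /(_ eps e0).
  rewrite /within /= nearE => /nbhs_ballP[d /= d0 hd].
  exists d => // s Is st; rewrite distrC; apply: hd => //.
  by rewrite /ball /= distrC.
apply/cvgrPdist_le => eps e0; have [d d0 hd] := h t It eps e0.
rewrite /within /= nearE; apply/nbhs_ballP; exists d => // s.
rewrite /ball /= distrC => st Is; rewrite distrC; exact: hd.
Qed.

Lemma deriv_on_cont f g : deriv_on f g -> cont_on f.
Proof.
move=> /deriv_onP h; apply/cont_onP => t It eps e0.
have [d d0 hd] := h t It 1 ltr01.
have p0 : 0 < 1 + `|g t| by rewrite ltr_pwDl.
exists (Num.min d (eps / (1 + `|g t|))).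
  by rewrite lt_min d0 /= divr_gt0.
move=> s Is; rewrite lt_min => /andP[sd].
rewrite ltr_pdivlMr // => se; have := hd s Is sd; rewrite mul1r => hs.
rewrite -[f s - f t](subrK ((s - t) * g t)).
apply: (le_trans (ler_normD _ _)); rewrite normrM.
apply: le_trans (ltW se); rewrite mulrDr mulr1.
by rewrite lerD.
Qed.

(** Since [I] has another point u, the segment from t to u lies in [I] and accumulates at t.
    Uniqueness of derivatives along [I] rests on this. *)
Lemma within_dnbhs_proper t : I t -> ProperFilter (within I t^').
Proof.
move=> It; apply: Build_ProperFilter_ex => P.
rewrite /within /= nearE => /nbhs_ballP[d /= d0 hd].
suff [s [Is st sd]] : exists s, [/\ I s, s != t & `|t - s| < d].
  by exists s; apply: hd.
have [u [Iu ut]] : exists u, I u /\ u != t.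
  have [a [b [Ia Ib ab]]] := hI2.
  have [->|bt] := eqVneq t b; last by exists b; rewrite eq_sym.
  by exists a; split => //; rewrite lt_eqF.
have [tu|tu|tu] := ltgtP t u; last by rewrite tu eqxx in ut.
  exists (Num.min u (t + d / 2)); split.
  - apply: (hI It Iu); rewrite ge_min lexx /= le_min ltW //= lerDl.
    by rewrite divr_ge0 // ltW.
  - by rewrite gt_eqF // lt_min tu /= ltrDl divr_gt0.
  - rewrite distrC ger0_norm.
      by rewrite ltrBlDl gt_min ltrD2l; apply/orP; right; lra.
    by rewrite subr_ge0 le_min (ltW tu) /= lerDl divr_ge0 // ltW.
exists (Num.max u (t - d / 2)); split.
- apply: (hI Iu It); rewrite le_max lexx /= ge_max (ltW tu) /= gerBl.
  by rewrite divr_ge0 // ltW.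
- by rewrite lt_eqF // gt_max tu /= gtrBl divr_gt0.
- rewrite ger0_norm.
    by rewrite ltrBlDr -ltrBlDl lt_max; apply/orP; right; lra.
  by rewrite subr_ge0 ge_max (ltW tu) /= gerBl divr_ge0 // ltW.
Qed.

Lemma deriv_on_unique f g1 g2 : deriv_on f g1 -> deriv_on f g2 ->
  forall t, I t -> g1 t = g2 t.
Proof.
move=> h1 h2 t It; have P := within_dnbhs_proper It.
exact: (cvg_unique _ (h1 t It) (h2 t It)).
Qed.

Lemma eq_deriv_on f1 f2 g1 g2 : deriv_on f1 g1 ->
  (forall t, I t -> f1 t = f2 t) -> (forall t, I t -> g1 t = g2 t) ->
  deriv_on f2 g2.
Proof.
move=> /deriv_onP h hf hg; apply/deriv_onP => t It eps e0.
have [d d0 hd] := h t It eps e0; exists d => // s Is.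
by rewrite -!hf // -hg //; exact: hd.
Qed.

Lemma deriv_on_cst c : deriv_on (fun=> c) (fun=> 0).
Proof.
apply/deriv_onP => t It eps e0; exists 1 => // s Is _.
by rewrite mulr0 subrr subr0 normr0 mulr_ge0 // ltW.
Qed.

Lemma deriv_onD f1 g1 f2 g2 : deriv_on f1 g1 -> deriv_on f2 g2 ->
  deriv_on (fun t => f1 t + f2 t) (fun t => g1 t + g2 t).
Proof.
move=> h1 h2 t It; have -> : (fun s => (f1 s + f2 s - (f1 t + f2 t)) / (s - t)) =
    (fun s => (f1 s - f1 t) / (s - t) + (f2 s - f2 t) / (s - t)).
  by apply/funext => s; move: ((s - t)^-1) => c; ring.
exact: cvgD (h1 t It) (h2 t It).
Qed.

Lemma deriv_onM f1 g1 f2 g2 : deriv_on f1 g1 -> deriv_on f2 g2 ->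
  deriv_on (fun t => f1 t * f2 t) (fun t => g1 t * f2 t + f1 t * g2 t).
Proof.
move=> h1 h2 t It; have c2 := deriv_on_cont h2.
have c2' : f2 @ within I t^' --> f2 t.
  apply: cvg_trans (c2 t It) => P.
  by move=> /nbhs_ballP[d d0 hd]; apply/nbhs_ballP; exists d => // s /hd h _; exact: h.
have -> : (fun s => (f1 s * f2 s - f1 t * f2 t) / (s - t)) =
    (fun s => (f1 s - f1 t) / (s - t) * f2 s + f1 t * ((f2 s - f2 t) / (s - t))).
  by apply/funext => s; move: ((s - t)^-1) => c; ring.
exact: cvgD (cvgM (h1 t It) c2') (cvgM (cvg_cst (f1 t)) (h2 t It)).
Qed.

Lemma deriv_onZ c f g : deriv_on f g ->
  deriv_on (fun t => c * f t) (fun t => c * g t).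
Proof.
move=> h; apply: (eq_deriv_on (deriv_onM (@deriv_on_cst c) h)) => // t _.
by rewrite mul0r add0r.
Qed.

Lemma deriv_onB f1 g1 f2 g2 : deriv_on f1 g1 -> deriv_on f2 g2 ->
  deriv_on (fun t => f1 t - f2 t) (fun t => g1 t - g2 t).
Proof.
move=> h1 h2; apply: (eq_deriv_on (deriv_onD h1 (@deriv_onZ (-1) _ _ h2))) => t _;
  by rewrite mulN1r.
Qed.

Lemma deriv_on_sum (T : Type) (r : seq T) (P : pred T) (f g : T -> R -> R) :
  (forall i, P i -> deriv_on (f i) (g i)) ->
  deriv_on (fun t => \sum_(i <- r | P i) f i t)
           (fun t => \sum_(i <- r | P i) g i t).
Proof.
move=> h; elim: r => [|i r IH].
  by apply: (eq_deriv_on (@deriv_on_cst 0)) => t _; rewrite big_nil.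
case Pi: (P i); last by apply: (eq_deriv_on IH) => t _; rewrite big_cons Pi.
by apply: (eq_deriv_on (deriv_onD (h i Pi) IH)) => t _; rewrite big_cons Pi.
Qed.

Lemma cont_on_within f s t : cont_on f -> I s -> I t ->
  {within `[s, t], continuous f}.
Proof.
move=> cf Is It; apply/subspace_continuousP => x /=.
rewrite in_itv /= => sxt; have Ix := hI Is It sxt.
apply: cvg_trans (cf x Ix) => P.
move=> /nbhs_ballP[d d0 hd]; apply/nbhs_ballP; exists d => // y xy.
by move=> yst; apply: hd => //; apply: (hI Is It); move: yst; rewrite /= in_itv.
Qed.

(** Mean value theorem on the segment from s to t: at its interior points the derivative along [I]
    is the ordinary one. *)
Lemma deriv_on_ge0_homo f g : deriv_on f g -> (forall t, I t -> 0 <= g t) ->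
  forall s t, I s -> I t -> s <= t -> f s <= f t.
Proof.
move=> hfg g0 s t Is It st.
have fx x : x \in `]s, t[ -> is_derive x 1 f (g x).
  rewrite in_itv /= => /andP[sx xt].
  have Ix : I x by apply: (hI Is It); rewrite !ltW.
  suff h : (fun h => h^-1 *: (f (h *: 1 + x) - f x)) @ 0^' --> g x.
    by apply: DeriveDef; [apply: cvgP h | apply: cvg_lim h => //; exact: Rhausdorff].
  apply/cvgrPdist_le => eps e0.
  move/deriv_onP: hfg => /(_ x Ix eps e0)[d d0 hd].
  near=> h.
  have h0 : h != 0 by near: h; exact: nbhs_dnbhs_neq.
  (* The last two bounds keep x + h between s and t, hence in [I]. *)
  have hs : `|h| < Num.min d (Num.min (x - s) (t - x)).
    near: h; apply: dnbhs0_lt; by rewrite !lt_min d0 !subr_gt0 sx.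
  move: hs; rewrite !lt_min ltr_norml => /and3P[/andP[hd1 hd2] hs ht].
  have Ihx : I (h *: 1 + x).
    by apply: (hI Is It); rewrite /GRing.scale /= mulr1; move: hs ht;
      rewrite !ltr_norml => /andP[? ?] /andP[? ?]; apply/andP; split; lra.
  have := hd _ Ihx; rewrite addrK /GRing.scale /= mulr1 ltr_norml hd1 hd2.
  move=> /(_ isT) h1; rewrite distrC -(ler_pM2r (x := `|h|)) ?normr_gt0 //.
  by rewrite -normrM mulrBl mulrAC mulVf // mul1r [g x * _]mulrC.
have [c cst E] := MVT_segment st fx (cont_on_within (deriv_on_cont hfg) Is It).
rewrite -subr_ge0 E mulr_ge0 ?subr_ge0 // g0 //; apply: (hI Is It).
by move: cst; rewrite in_itv.
Unshelve. all: by end_near. Qed.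

(** Both F + f and F - f have a nonnegative derivative. A bound that varies with t is allowed
    because the Picard estimates grow like powers of the distance to t0. *)
Lemma deriv_on_le f g F G : deriv_on f g -> deriv_on F G ->
  (forall t, I t -> `|g t| <= G t) ->
  forall s t, I s -> I t -> s <= t -> `|f t - f s| <= F t - F s.
Proof.
move=> hf hF le s t Is It st; rewrite ler_norml; apply/andP; split.
  have := deriv_on_ge0_homo (deriv_onD hF hf) _ Is It st.
  suff h : forall u, I u -> 0 <= G u + g u by move=> /(_ h); lra.
  by move=> u /le; rewrite ler_norml => /andP[? _]; lra.
have := deriv_on_ge0_homo (deriv_onB hF hf) _ Is It st.
suff h : forall u, I u -> 0 <= G u - g u by move=> /(_ h); lra.
by move=> u /le; rewrite ler_norml => /andP[_ ?]; lra.
Qed.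

Lemma deriv_on0_cst f : deriv_on f (fun=> 0) ->
  forall s t, I s -> I t -> f s = f t.
Proof.
move=> hf; suff H s t : I s -> I t -> s <= t -> f s = f t.
  move=> s t Is It; case: (leP s t) => [|/ltW] /H -> //.
move=> Is It st; have := deriv_on_le hf (@deriv_on_cst 0) _ Is It st.
rewrite subrr => h; apply/eqP; rewrite eq_sym -subr_eq0 -normr_eq0 eq_le.
by rewrite normr_ge0 h // => u _; rewrite normr0.
Qed.

End DerivativesOnIntervals.

(** * Primitives of continuous functions and derivatives of limits *)

Section Primitives.
Variables (R : realType) (I : set R).
Hypothesis hI : is_interval I.
Notation mu := (@lebesgue_measure R).

Lemma cont_on_integrable f s t : cont_on I f -> I s -> I t ->
  mu.-integrable `[s, t] (EFin \o f).
Proof.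
move=> cf Is It; apply: continuous_compact_integrable.
  exact: segment_compact.
exact: (cont_on_within hI cf Is It).
Qed.

Lemma Rintegral_chasles f s x t : cont_on I f -> I s -> I t -> s <= x <= t ->
  (\int[mu]_(u in `[s, t]) f u =
   \int[mu]_(u in `[s, x]) f u + \int[mu]_(u in `[x, t]) f u)%R.
Proof.
move=> cf Is It /andP[sx xt]; have Ix : I x by apply: (hI Is It); rewrite sx.
have := @Rintegral_itvB R f (BLeft s) (BRight t) x (cont_on_integrable cf Is It).
rewrite !bnd_simp => /(_ sx xt) h.
rewrite Rintegral_itv_obnd_cbnd in h; first by rewrite -h; ring.
apply: integrableS (cont_on_integrable cf Ix It) => //.
by apply: subset_itvr; rewrite bnd_simp.
Qed.

(** The integral over a set has no orientation, hence the sign when t lies before t0. *)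
Definition primitive (t0 : R) (f : R -> R) (t : R) : R :=
  if t0 <= t then (\int[mu]_(u in `[t0, t]) f u)%R
  else - (\int[mu]_(u in `[t, t0]) f u)%R.

Lemma primitive0 t0 f : primitive t0 f t0 = 0.
Proof. by rewrite /primitive lexx set_itv1 Rintegral_set1. Qed.

Lemma primitiveB t0 f s t : cont_on I f -> I t0 -> I s -> I t -> s <= t ->
  primitive t0 f t - primitive t0 f s = (\int[mu]_(u in `[s, t]) f u)%R.
Proof.
move=> cf It0 Is It st; rewrite /primitive.
have [t0s|st0] := leP t0 s.
  rewrite (le_trans t0s st) (@Rintegral_chasles f t0 s t) ?t0s ?st //.
  by rewrite addrC addKr.
have [t0t|tt0] := leP t0 t.
  by rewrite (@Rintegral_chasles f s t0 t) ?(ltW st0) //; ring.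
by rewrite (@Rintegral_chasles f s t t0) ?st ?ltW //; ring.
Qed.

Lemma Rintegral_itv_cst_dist f c eps s t : cont_on I f -> I s -> I t -> s <= t ->
  (forall u, s <= u <= t -> `|f u - c| <= eps) ->
  `|(\int[mu]_(u in `[s, t]) f u)%R - (t - s) * c| <= eps * (t - s).
Proof.
move=> cf Is It st h.
have cst (k : R) : (\int[mu]_(u in `[s, t]) k)%R = (t - s) * k.
  rewrite /Rintegral integral_cst; last exact: measurable_itv.
  rewrite /= lebesgue_measure_itv /= lte_fin.
  move: st; rewrite le_eqVlt => /predU1P[->|st]; last first.
    by rewrite st /= mulrC.
  by rewrite ltxx subrr mul0r mule0.
have icst (k : R) : mu.-integrable `[s, t] (EFin \o (fun=> k)).
  by apply: (cont_on_integrable _ Is It) => x _; exact: cvg_cst.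
have fi := cont_on_integrable cf Is It.
rewrite ler_norml; apply/andP; split.
  have := @le_Rintegral _ _ _ mu `[s, t]%classic (fun=> c - eps) f
    (measurable_itv _) (icst _) fi.
  rewrite cst => le; rewrite -subr_ge0; apply: le_trans
    (_ : 0 <= (\int[mu]_(u in `[s, t]) f u)%R - (t - s) * (c - eps)) _.
    rewrite subr_ge0; apply: le => u; rewrite /= in_itv /= => /h.
    by rewrite ler_norml => /andP[? _]; lra.
  by rewrite le_eqVlt; apply/orP; left; apply/eqP; ring.
have := @le_Rintegral _ _ _ mu `[s, t]%classic f (fun=> c + eps)
  (measurable_itv _) fi (icst _).
rewrite cst => le; rewrite -subr_ge0; apply: le_trans
  (_ : 0 <= (t - s) * (c + eps) - (\int[mu]_(u in `[s, t]) f u)%R) _.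
  rewrite subr_ge0; apply: le => u; rewrite /= in_itv /= => /h.
  by rewrite ler_norml => /andP[_ ?]; lra.
by rewrite le_eqVlt; apply/orP; left; apply/eqP; ring.
Qed.

(** The increment between s and t is an integral over the segment joining them, on which f is within
    eps of f t by continuity; this covers the endpoints of [I]. *)
Lemma deriv_on_primitive t0 f : cont_on I f -> I t0 ->
  deriv_on I (primitive t0 f) f.
Proof.
move=> cf It0; apply/deriv_onP => t It eps e0.
have [d d0 hd] := (iffLR (cont_onP I f) cf) t It eps e0; exists d => // s Is.
rewrite ltr_norml => /andP[h1 h2].
have [st|ts] := leP s t.
  rewrite (_ : _ - _ = - (primitive t0 f t - primitive t0 f s - (t - s) * f t));
    last by ring.
  rewrite normrN primitiveB // [`|s - t|]distrC [`|t - s|]ger0_norm ?subr_ge0 //.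
  apply: Rintegral_itv_cst_dist => // u /andP[su ut].
  apply: hd; first by apply: (hI Is It); rewrite su.
  by rewrite ltr_norml; apply/andP; split; lra.
have ts' := ltW ts; rewrite primitiveB // [`|s - t|]ger0_norm ?subr_ge0 //.
apply: Rintegral_itv_cst_dist => // u /andP[su ut].
apply: hd; first by apply: (hI It Is); rewrite su.
by rewrite ltr_norml; apply/andP; split; lra.
Qed.

Lemma deriv_on_subset (J : set R) f g : J `<=` I -> deriv_on I f g ->
  deriv_on J f g.
Proof.
move=> JI /deriv_onP h; apply/deriv_onP => t /JI It eps /(h t It)[d d0 hd].
by exists d => // s /JI; exact: hd.
Qed.

(** The error for f splits into three: the error of a single [F N] at t (eps / 4), the distance from
    [G N t] to g t (eps / 4), and the increment of [F N] - f, controlled by the mean value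
    inequality (eps / 2). *)
Lemma deriv_on_lim (F G : nat -> R -> R) (f g : R -> R) :
  (forall n, deriv_on I (F n) (G n)) ->
  (forall t, I t -> F ^~ t @ \oo --> f t) ->
  (forall t, I t -> forall eps, 0 < eps -> exists2 d, 0 < d & exists N,
     forall n s, (N <= n)%N -> I s -> `|s - t| < d -> `|G n s - g s| <= eps) ->
  deriv_on I f g.
Proof.
move=> hFG Ff Gg; apply/deriv_onP => t It eps e0.
have e40 : 0 < eps / 4 by rewrite divr_gt0.
have [d1 d10 [N hN]] := Gg t It (eps / 4) e40.
have [d2 d20 hd2] := (iffLR (deriv_onP I _ _) (hFG N)) t It (eps / 4) e40.
exists (Num.min d1 d2); first by rewrite lt_min d10.
move=> s Is; rewrite lt_min => /andP[sd1 sd2].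
pose J := I `&` [set u | `|u - t| < d1].
have hJ : is_interval J.
  move=> x y [Ix xd] [Iy yd] z /andP[xz zy]; split.
    by apply: (hI Ix Iy); rewrite xz.
  move: xd yd => /=; rewrite !ltr_norml => /andP[? ?] /andP[? ?].
  by apply/andP; split; lra.
have Jt : J t by split => //=; rewrite subrr normr0.
have Js : J s by [].
have JI : J `<=` I by move=> ? [].
(* On [J] both [G N] and [G m] are within eps / 4 of g, so the derivative of [F N] - [F m] is at
   most eps / 2 there. *)
have key m : (N <= m)%N ->
    `|F N s - F m s - (F N t - F m t)| <= eps / 2 * `|s - t|.
  move=> Nm; pose H u := F N u - F m u; pose H' u := G N u - G m u.
  have hH : deriv_on J H H'.
    by apply: deriv_on_subset JI _; apply: deriv_onB.
  have hG : deriv_on J (fun u => eps / 2 * u) (fun=> eps / 2).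
    apply/deriv_onP => u _ e e1; exists 1 => // v _ _.
    by rewrite (_ : _ - _ = 0) ?normr0 ?mulr_ge0 ?(ltW e1) //; ring.
  have le u : J u -> `|H' u| <= eps / 2.
    move=> [Iu ud]; rewrite /H' (_ : _ - _ = G N u - g u - (G m u - g u)); last by ring.
    apply: (le_trans (ler_normB _ _)).
    have := hN N u (leqnn _) Iu ud; have := hN m u Nm Iu ud; lra.
  have [st|ts] := leP s t.
    have := deriv_on_le hJ hH hG le Js Jt st.
    by rewrite -/(H s) -/(H t) distrC [`|s - t|]distrC -mulrBr
      [`|t - s|]ger0_norm ?subr_ge0.
  have := deriv_on_le hJ hH hG le Jt Js (ltW ts).
  by rewrite -mulrBr [`|s - t|]ger0_norm ?subr_ge0 // ltW.
(* The bound in [key] does not involve m, so it survives the passage to the limit in m. *)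
have key2 : `|F N s - f s - (F N t - f t)| <= eps / 2 * `|s - t|.
  have c : (fun m => `|F N s - F m s - (F N t - F m t)|) @ \oo -->
      `|F N s - f s - (F N t - f t)|.
    apply: cvg_norm; apply: cvgB; apply: cvgB; try exact: cvg_cst.
      exact: Ff.
    exact: Ff.
  rewrite -(cvg_lim (@Rhausdorff R) c); apply: limr_le; first exact: cvgP c.
  by exists N => // m /= /key.
have := hd2 s Is sd2; have := hN N t (leqnn _) It; rewrite subrr normr0.
move=> /(_ d10) k3 k4.
have k5 : `|(s - t) * (G N t - g t)| <= eps / 4 * `|s - t|.
  by rewrite normrM mulrC ler_wpM2r.
rewrite (_ : f s - f t - (s - t) * g t =
  F N s - F N t - (s - t) * G N t + (s - t) * (G N t - g t)
  - (F N s - f s - (F N t - f t))); last by ring.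
apply: (le_trans (ler_normB _ _)).
apply: (le_trans (lerD (ler_normD _ _) (lexx _))).
by lra.
Qed.

Lemma deriv_on_XS f g n : deriv_on I f g ->
  deriv_on I (fun t => f t ^+ n.+1) (fun t => n.+1%:R * f t ^+ n * g t).
Proof.
move=> h; elim: n => [|n IH].
  by apply: (eq_deriv_on h) => t _; rewrite ?expr1 // expr0 !mul1r.
apply: (eq_deriv_on (deriv_onM h IH)) => t _; first by rewrite -exprS.
by rewrite [in RHS]mulrS exprS; ring.
Qed.

End Primitives.

(** * Linear differential equations *)

Section ContinuousFunctions.
Variables (R : realType) (I : set R).
Hypothesis hI : is_interval I.

Lemma cont_onD f g : cont_on I f -> cont_on I g -> cont_on I (fun t => f t + g t).
Proof. by move=> hf hg t It; apply: cvgD; [exact: hf|exact: hg]. Qed.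

Lemma cont_onM f g : cont_on I f -> cont_on I g -> cont_on I (fun t => f t * g t).
Proof. by move=> hf hg t It; apply: cvgM; [exact: hf|exact: hg]. Qed.

Lemma cont_on_sum (T : Type) (r : seq T) (f : T -> R -> R) :
  (forall i, cont_on I (f i)) -> cont_on I (fun t => \sum_(i <- r) f i t).
Proof.
move=> h; elim: r => [|i r IH].
  rewrite (_ : (fun t => _) = fun=> 0) => [t _|]; first exact: cvg_cst.
  by apply/funext => t; rewrite big_nil.
rewrite (_ : (fun t => _) = fun t => f i t + \sum_(j <- r) f j t).
  by apply: cont_onD.
by apply/funext => t; rewrite big_cons.
Qed.

(** The division by n + 1 is what produces the factorial in the Picard estimate. The two sides of t0
    are treated separately, with a nondecreasing comparison function on each: a multiple of (t -
    t0)^(n+1) on the right, minus a multiple of (t0 - t)^(n+1) on the left. *)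
Lemma deriv_on_growth (t0 B : R) n F f : I t0 -> 0 <= B -> F t0 = 0 ->
  deriv_on I F f -> (forall t, I t -> `|f t| <= B * `|t - t0| ^+ n) ->
  forall t, I t -> `|F t| <= B / n.+1%:R * `|t - t0| ^+ n.+1.
Proof.
move=> It0 B0 F0 hF hf t It.
have n0 : n.+1%:R != 0 :> R by rewrite pnatr_eq0.
have did (J : set R) : deriv_on J id (fun=> 1).
  by apply/deriv_onP => u _ e e0; exists 1 => // v _ _;
    rewrite mulr1 subrr normr0 mulr_ge0 // ltW.
have [tt0|t0t] := leP t t0.
  pose J := I `&` [set u | u <= t0].
  have hJ : is_interval J.
    move=> x y [Ix xd] [Iy yd] z /andP[xz zy]; split => /=.
      by apply: (hI Ix Iy); rewrite xz.
    exact: le_trans yd.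
  have hG : deriv_on J (fun u => - B / n.+1%:R * (t0 - u) ^+ n.+1)
                       (fun u => B * (t0 - u) ^+ n).
    have h := @deriv_on_XS _ _ _ _ n (deriv_onB (@deriv_on_cst _ J t0) (did J)).
    apply: (eq_deriv_on (@deriv_onZ _ _ (- B / n.+1%:R) _ _ h)) => // u _ /=.
    by rewrite -[RHS]mul1r -[X in X * (B * _)](mulfV n0); ring.
  have := deriv_on_le hJ (deriv_on_subset (J := J) _ hF) hG _ _ _ tt0.
  rewrite F0 sub0r normrN subrr expr0n /= mulr0 sub0r mulNr mulNr opprK.
  rewrite [`|t - t0|]distrC [`|t0 - t|]ger0_norm ?subr_ge0 //; apply => //.
    by move=> u [].
  move=> u [Iu /= ut]; have := hf u Iu.
  by rewrite [`|u - t0|]distrC [`|t0 - u|]ger0_norm // subr_ge0.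
  by split => /=.
pose J := I `&` [set u | t0 <= u].
have hJ : is_interval J.
  move=> x y [Ix xd] [Iy yd] z /andP[xz zy]; split => /=.
    by apply: (hI Ix Iy); rewrite xz.
  exact: le_trans xz.
have hG : deriv_on J (fun u => B / n.+1%:R * (u - t0) ^+ n.+1)
                     (fun u => B * (u - t0) ^+ n).
  have h := @deriv_on_XS _ _ _ _ n (deriv_onB (did J) (@deriv_on_cst _ J t0)).
  apply: (eq_deriv_on (@deriv_onZ _ _ (B / n.+1%:R) _ _ h)) => // u _ /=.
  by rewrite -[RHS]mul1r -[X in X * (B * _)](mulfV n0); ring.
have := deriv_on_le hJ (deriv_on_subset (J := J) _ hF) hG _ _ _ (ltW t0t).
rewrite F0 subr0 subrr expr0n /= mulr0 subr0.
rewrite [`|t - t0|]ger0_norm ?subr_ge0 ?(ltW t0t) //; apply => //.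
- by move=> u [].
- move=> u [Iu /= ut]; have := hf u Iu.
  by rewrite [`|u - t0|]ger0_norm // subr_ge0.
- by split => /=.
- by split => //=; exact: ltW.
Qed.

(** A compact subinterval of [I] that contains t0 and is a neighbourhood of t relative to [I]:
    continuous coefficients are bounded on it, while they may be unbounded on [I]. *)
Lemma interval_localize t0 t : I t0 -> I t -> exists a b d,
  [/\ I a, I b, a <= t0 <= b, 0 < d &
      forall s, I s -> `|s - t| < d -> a <= s <= b].
Proof.
move=> It0 It.
have [b [d1 [Ib t0b d10 hb]]] : exists b d, [/\ I b, t0 <= b, 0 < d &
    forall s, I s -> `|s - t| < d -> s <= b].
  (* If [I] has no point beyond t, then t is its last point and bounds all of [I], so any radius
     will do. *)
  have [[b [Ib tb]]|nb] := pselect (exists b, I b /\ t < b).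
    exists (Num.max t0 b), (b - t); split; rewrite ?subr_gt0 ?le_max ?lexx //.
      by rewrite maxEle; case: ifP.
    move=> s _; rewrite ltr_norml => /andP[_ h]; rewrite le_max.
    by apply/orP; right; lra.
  exists (Num.max t0 t), 1; split; rewrite ?le_max ?lexx //.
    by rewrite maxEle; case: ifP.
  move=> s Is _; rewrite le_max; apply/orP; right; rewrite leNgt.
  by apply/negP => ts; apply: nb; exists s.
have [a [d2 [Ia at0 d20 ha]]] : exists a d, [/\ I a, a <= t0, 0 < d &
    forall s, I s -> `|s - t| < d -> a <= s].
  have [[a [Ia ta]]|na] := pselect (exists a, I a /\ a < t).
    exists (Num.min t0 a), (t - a); split; rewrite ?subr_gt0 ?ge_min ?lexx //.
      by rewrite minEle; case: ifP.
    move=> s _; rewrite ltr_norml => /andP[h _]; rewrite ge_min.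
    by apply/orP; right; lra.
  exists (Num.min t0 t), 1; split; rewrite ?ge_min ?lexx //.
    by rewrite minEle; case: ifP.
  move=> s Is _; rewrite ge_min; apply/orP; right; rewrite leNgt.
  by apply/negP => ts; apply: na; exists s.
exists a, b, (Num.min d1 d2); split; rewrite ?at0 ?lt_min ?d10 //.
by move=> s Is; rewrite lt_min => /andP[h1 h2]; rewrite ha ?hb.
Qed.

Lemma cont_on_bounded f a b : cont_on I f -> I a -> I b -> a <= b ->
  exists M, forall t, a <= t <= b -> `|f t| <= M.
Proof.
move=> cf Ia Ib ab.
have c : {within `[a, b], continuous (fun t => `|f t|)}.
  by apply: (cont_on_within hI) => // t It; apply: cvg_norm; exact: cf.
have [x _ hx] := EVT_max ab c; exists `|f x| => t tab.
by apply: hx; rewrite in_itv.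
Qed.

End ContinuousFunctions.

(** * The Picard series of a linear system *)

Section Picard.
Variables (R : realType) (I : set R).
Hypothesis hI : is_interval I.
Variables (T : finType) (A : T -> T -> R -> R) (t0 : R) (c : T -> R).
Hypotheses (cA : forall i j, cont_on I (A i j)) (It0 : I t0).

(** This is the n-th term of the series, an n-fold iterated integral; the usual Picard iterates are
    the partial sums. *)
Fixpoint picard (n : nat) (i : T) : R -> R :=
  if n is m.+1 then primitive t0 (fun t => \sum_j A i j t * picard m j t)
  else fun=> c i.

Lemma picard_cont n i : cont_on I (picard n i).
Proof.
elim: n i => [|n IH] i; first by move=> t _; exact: cvg_cst.
apply: deriv_on_cont (deriv_on_primitive hI _ It0).
by apply: cont_on_sum => j; apply: cont_onM.
Qed.

Lemma picard_deriv n i :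
  deriv_on I (picard n.+1 i) (fun t => \sum_j A i j t * picard n j t).
Proof.
apply: deriv_on_primitive => //.
by apply: cont_on_sum => j; apply: cont_onM => //; exact: picard_cont.
Qed.

(** By induction the n-th term is at most C (K |t - t0|)^n / n!, each integration contributing a
    factor K |t - t0| / (n+1); then |t - t0| is at most b - a. *)
Lemma picard_bound a b : I a -> I b -> a <= t0 <= b -> exists C K,
  [/\ 0 <= C, 0 <= K,
      forall n i t, a <= t <= b ->
        `|picard n i t| <= C * exp_coeff (K * (b - a)) n
    & forall i t (y : T -> R) B, a <= t <= b -> (forall j, `|y j| <= B) ->
        `|\sum_j A i j t * y j| <= K * B].
Proof.
move=> Ia Ib /andP[at0 t0b]; have ab := le_trans at0 t0b.
have /choice[M hM] : forall ij : T * T, exists M,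
    forall t, a <= t <= b -> `|A ij.1 ij.2 t| <= M.
  by move=> [i j] /=; exact: (cont_on_bounded hI (@cA i j) Ia Ib ab).
have M0 ij : 0 <= M ij by apply: le_trans (hM ij t0 _); rewrite ?at0.
(* K bounds the norm of the coefficient matrix for the maximum norm throughout [a, b], and C bounds
   every initial value. *)
pose K := \sum_ij M ij; pose C := \sum_i `|c i|.
have K0 : 0 <= K by apply: sumr_ge0.
have C0 : 0 <= C by apply: sumr_ge0.
have hK i t (y : T -> R) B : a <= t <= b -> (forall j, `|y j| <= B) ->
    `|\sum_j A i j t * y j| <= K * B.
  move=> tab yB; have B0 : 0 <= B by apply: le_trans (yB i).
  apply: (le_trans (ler_norm_sum _ _ _)).
  apply: (@le_trans _ _ ((\sum_j M (i, j)) * B)).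
    rewrite mulr_suml; apply: ler_sum => j _; rewrite normrM.
    by apply: ler_pM => //; exact: (hM (i, j)).
  apply: ler_wpM2r => //; rewrite /K.
  have -> : \sum_ij M ij = \sum_i \sum_j M (i, j).
    by rewrite pair_bigA; apply: eq_bigr => -[].
  rewrite [leRHS](bigD1 i) //= lerDl.
  by apply: sumr_ge0 => k _; apply: sumr_ge0.
pose J := I `&` [set t | a <= t <= b].
have hJ : is_interval J.
  move=> x y [Ix /andP[ax xb]] [Iy /andP[ay yb]] z /andP[xz zy]; split => /=.
    by apply: (hI Ix Iy); rewrite xz.
  by rewrite (le_trans ax xz) (le_trans zy yb).
have Jt0 : J t0 by split => //=; rewrite at0.
have JI : J `<=` I by move=> ? [].
have hp n i t : J t ->
    `|picard n i t| <= C * K ^+ n / n`!%:R * `|t - t0| ^+ n.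
  elim: n i t => [|n IH] i t Jt.
    rewrite fact0 divr1 !expr0 !mulr1 /= /C (bigD1 i) //= lerDl.
    exact: sumr_ge0.

  have -> : C * K ^+ n.+1 / n.+1`!%:R = K * (C * K ^+ n / n`!%:R) / n.+1%:R.
    rewrite factS natrM exprS; field.
    by rewrite nat1r !pnatr_eq0 /= -lt0n fact_gt0.
  have bnd s : J s -> `|\sum_j A i j s * picard n j s| <=
      K * (C * K ^+ n / n`!%:R) * `|s - t0| ^+ n.
    by move=> Js; rewrite -mulrA; apply: hK; [case: Js|move=> j; exact: IH].
  have B0 : 0 <= K * (C * K ^+ n / n`!%:R).
    by rewrite mulr_ge0 // divr_ge0 // mulr_ge0 // exprn_ge0.
  apply: (deriv_on_growth hJ Jt0 B0 (primitive0 _ _)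
    (deriv_on_subset JI (@picard_deriv n i)) bnd Jt).
exists C, K; split => // n i t tab.
have It : I t by apply: (hI Ia Ib).
apply: (le_trans (hp n i t _)) => //; rewrite /exp_coeff /=.
rewrite exprMn -!mulrA ler_wpM2l // ler_wpM2l ?exprn_ge0 //.
rewrite mulrC ler_wpM2r ?invr_ge0 // lerXn2r ?nnegrE ?subr_ge0 //.
by move: tab => /andP[? ?]; rewrite ler_norml; apply/andP; split; lra.
Qed.

Lemma picard_cvg t i : I t -> cvgn (series (fun n => picard n i t)).
Proof.
move=> It; have [a [b [d [Ia Ib ab d0 hd]]]] := interval_localize It0 It.
have [C [K [C0 K0 hp _]]] := picard_bound Ia Ib ab.
have tab : a <= t <= b by apply: hd; rewrite // subrr normr0.
have x0 : 0 <= K * (b - a).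
  by rewrite mulr_ge0 // subr_ge0; move/andP: ab => [? ?]; lra.
apply: normed_cvg.
apply: (@series_le_cvg _ _ (fun n => C * exp_coeff (K * (b - a)) n)) => /=.
- by [].
- by move=> n; rewrite mulr_ge0 // exp_coeff_ge0.
- by move=> n; exact: hp.
by apply: is_cvg_seriesZ; exact: is_cvg_series_exp_coeff.
Qed.

Definition picard_sum (i : T) (t : R) : R := limn (series (fun n => picard n i t)).

(** The tail is dominated by that of an exponential series which depends neither on the index i nor
    on the point s near t, whence the uniform N. *)
Lemma picard_sum_dist t eps : I t -> 0 < eps -> exists2 d, 0 < d & exists N,
  forall n i s, (N <= n)%N -> I s -> `|s - t| < d ->
    `|series (fun k => picard k i s) n - picard_sum i s| <= eps.
Proof.
move=> It e0; have [a [b [d [Ia Ib ab d0 hd]]]] := interval_localize It0 It.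
have [C [K [C0 K0 hp _]]] := picard_bound Ia Ib ab.
exists d => //; pose x n := C * exp_coeff (K * (b - a)) n.
have x0 n : 0 <= x n.
  rewrite mulr_ge0 // exp_coeff_ge0 // mulr_ge0 // subr_ge0.
  by move/andP: ab => [? ?]; lra.
have cx : cvgn (series x).
  by apply: is_cvg_seriesZ; exact: is_cvg_series_exp_coeff.
have [N _ hN] := (iffLR (cvgrPdist_le _ _) cx) eps e0.
exists N => n i s Nn Is sd.
have hc : (fun m => `|series (fun k => picard k i s) n -
    series (fun k => picard k i s) m|) @ \oo -->
    `|series (fun k => picard k i s) n - picard_sum i s|.
  by apply: cvg_norm; apply: cvgB; [exact: cvg_cst|exact: picard_cvg].
rewrite -(cvg_lim (@Rhausdorff R) hc); apply: limr_le; first exact: cvgP hc.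
exists n => // m /= nm; rewrite distrC sub_series_geq //.
apply: (le_trans (ler_norm_sum _ _ _)).
apply: (@le_trans _ _ (\sum_(n <= k < m) x k)).
  by apply: ler_sum => k _; apply: hp; exact: hd.
rewrite -sub_series_geq //; have := hN n Nn => /=.
have nd : nondecreasing_seq (series x).
  exact: (nondecreasing_series (fun n _ _ => x0 n)).
have h1 := nd n m nm; have h2 := nondecreasing_cvgn_le nd cx m.
by rewrite ler_norml => /andP[_ ?]; lra.
Qed.

Lemma picard_sum_deriv i :
  deriv_on I (picard_sum i) (fun t => \sum_j A i j t * picard_sum j t).
Proof.
pose S n i t := series (fun k => picard k i t) n.
(* Differentiation kills the constant term of the series and lowers the index of the others: the
   derivative of [S n.+1] is the matrix applied to [S n]. *)
apply: (@deriv_on_lim _ _ hI (fun n => S n.+1 i)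
  (fun n t => \sum_j A i j t * S n j t)).
- move=> n; elim: n => [|n IH].
    apply: (eq_deriv_on (@deriv_on_cst _ _ (c i))) => t _.
      by rewrite /S seriesEnat /= big_nat1.
    by rewrite big1 // => j _; rewrite /S seriesEnat /= big_nil mulr0.
  apply: (eq_deriv_on (deriv_onD IH (@picard_deriv n i))) => t _.
    by rewrite /S !seriesEnat /= [RHS]big_nat_recr.
  rewrite -big_split; apply: eq_bigr => j _ /=.
  by rewrite /S !seriesEnat /= [in RHS]big_nat_recr //= mulrDr.
- move=> t It; have := @picard_cvg t i It.
  by rewrite -(cvg_shiftS (series _)).
- move=> t It eps e0.
  have [a [b [d [Ia Ib ab d0 hd]]]] := interval_localize It0 It.
  have [C [K [C0 K0 _ hK]]] := picard_bound Ia Ib ab.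
  (* K may be 0, hence the division by K + 1. *)
  have K1 : 0 < K + 1 by rewrite ltr_wpDl.
  have eK : 0 < eps / (K + 1) by rewrite divr_gt0.
  have [d' d'0 [N hN]] := picard_sum_dist It eK.
  exists (Num.min d d'); first by rewrite lt_min d0.
  exists N => n s Nn Is; rewrite lt_min => /andP[sd sd'].
  rewrite -sumrB; under eq_bigr do rewrite -mulrBr.
  apply: (le_trans (hK i s _ (eps / (K + 1)) (hd s Is sd) _)).
    by move=> j; exact: hN.
  rewrite mulrC mulrAC ler_pdivrMr //; apply: ler_wpM2l; first exact: ltW.
  by rewrite lerDl.
Qed.

Lemma picard_sum0 i : picard_sum i t0 = c i.
Proof.
apply: cvg_lim => //; rewrite -(cvg_shiftS (series _)).
rewrite (_ : (fun n => _) = fun=> c i); first exact: cvg_cst.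
apply/funext => n /=; rewrite seriesEnat /= big_nat_recl //= big1 ?addr0 //.
by move=> k _; rewrite primitive0.
Qed.

End Picard.

Lemma linear_ode_scalar (R : realType) (I : set R) (T : finType)
    (A : T -> T -> R -> R) (t0 : R) (c : T -> R) :
  is_interval I -> (forall i j, cont_on I (A i j)) -> I t0 ->
  exists y : T -> R -> R, (forall i, y i t0 = c i) /\
    forall i, deriv_on I (y i) (fun t => \sum_j A i j t * y j t).
Proof.
move=> hI cA It0; exists (picard_sum A t0 c); split=> i.
  exact: picard_sum0.
exact: picard_sum_deriv.
Qed.

(** * Vector-valued functions *)

Section VectorDerivatives.
Variables (R : realType) (I : set R).
Hypotheses (hI : is_interval I) (hI2 : exists s t : R, [/\ I s, I t & s < t]).

Lemma eq_has_deriv_on (W : vectType R) (f1 f2 g1 g2 : R -> W) :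
  has_deriv_on I f1 g1 ->
  (forall t, I t -> f1 t = f2 t) -> (forall t, I t -> g1 t = g2 t) ->
  has_deriv_on I f2 g2.
Proof.
move=> h hf hg phi; apply: (eq_deriv_on (h phi)) => t It /=; first by rewrite hf.
by rewrite hg.
Qed.

Lemma has_deriv_on_unique (W : vectType R) (f g1 g2 : R -> W) :
  has_deriv_on I f g1 -> has_deriv_on I f g2 -> forall t, I t -> g1 t = g2 t.
Proof.
move=> h1 h2 t It.
rewrite (coord_vbasis (memvf (g1 t))) (coord_vbasis (memvf (g2 t))).
apply: eq_bigr => i _; congr (_ *: _).
exact: (deriv_on_unique hI hI2 (h1 (coord (vbasis fullv) i))
  (h2 (coord (vbasis fullv) i)) It).
Qed.

Lemma has_deriv_on_linear (W V : vectType R) (L : {linear W -> V}) (f g : R -> W) :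
  has_deriv_on I f g -> has_deriv_on I (L \o f) (L \o g).
Proof. by move=> h phi; exact: (h (phi \o L)). Qed.

Lemma has_deriv_onD (W : vectType R) (f1 f2 g1 g2 : R -> W) :
  has_deriv_on I f1 g1 -> has_deriv_on I f2 g2 ->
  has_deriv_on I (fun t => f1 t + f2 t) (fun t => g1 t + g2 t).
Proof.
by move=> h1 h2 phi; apply: (eq_deriv_on (deriv_onD (h1 phi) (h2 phi))) => t _;
  rewrite linearD.
Qed.

Lemma has_deriv_onN (W : vectType R) (f g : R -> W) :
  has_deriv_on I f g -> has_deriv_on I (fun t => - f t) (fun t => - g t).
Proof. exact: (@has_deriv_on_linear _ _ (-%R)). Qed.

Lemma has_deriv_on0 (W : vectType R) : has_deriv_on I (fun=> 0 : W) (fun=> 0).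
Proof.
by move=> phi; apply: (eq_deriv_on (@deriv_on_cst _ _ 0)) => t _;
  rewrite linear0.
Qed.

Lemma has_deriv_onR (f g : R -> R) :
  has_deriv_on I (f : R -> R^o) (g : R -> R^o) <-> deriv_on I f g.
Proof.
split=> [h|h phi].
  exact: (h (idfun : {scalar R^o})).
have E (x : R^o) : phi x = phi 1 * x.
  by rewrite -[in LHS](mulr1 x) -[x * 1]/(x *: (1 : R^o)) linearZ /= mulrC.
by apply: (eq_deriv_on (@deriv_onZ _ _ (phi 1) _ _ h)) => t _; rewrite -E.
Qed.

Lemma has_deriv_onZ (W : vectType R) (c d : R -> R) (f g : R -> W) :
  deriv_on I c d -> has_deriv_on I f g ->
  has_deriv_on I (fun t => c t *: f t) (fun t => d t *: f t + c t *: g t).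
Proof.
move=> hc h phi; apply: (eq_deriv_on (deriv_onM hc (h phi))) => t _.
  by rewrite linearZ.
by rewrite linearD !linearZ.
Qed.

Lemma has_deriv_on_sum (W : vectType R) (T : Type) (r : seq T)
    (f g : T -> R -> W) :
  (forall i, has_deriv_on I (f i) (g i)) ->
  has_deriv_on I (fun t => \sum_(i <- r) f i t) (fun t => \sum_(i <- r) g i t).
Proof.
move=> h phi; have := deriv_on_sum (r := r) (P := xpredT) (fun i _ => h i phi).
by move/eq_deriv_on; apply => t _; rewrite linear_sum.
Qed.

(** Weak derivatives only see linear functionals, so B is expanded along a basis of W into a sum of
    products of scalar functions, to which the product rule applies. *)
Lemma deriv_on_bilinear (W V : vectType R) (B : W -> V -> R) (f f' : R -> W)
    (g g' : R -> V) :
  (forall v, scalar (B^~ v)) -> (forall u, scalar (B u)) ->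
  has_deriv_on I f f' -> has_deriv_on I g g' ->
  deriv_on I (fun t => B (f t) (g t)) (fun t => B (f' t) (g t) + B (f t) (g' t)).
Proof.
move=> Bl Br hf hg.
pose bl v : {scalar W} := HB.pack (B^~ v) (GRing.isLinear.Build _ _ _ _ (B^~ v) (Bl v)).
pose br u : {scalar V} := HB.pack (B u) (GRing.isLinear.Build _ _ _ _ (B u) (Br u)).
pose b := vbasis {:W}.
have BE u v : B u v = \sum_i coord b i u * B b`_i v.
  rewrite [in LHS](coord_vbasis (memvf u)) -[B _ v]/(bl v _) linear_sum.
  by apply: eq_bigr => i _; rewrite linearZ.
have := deriv_on_sum (r := index_enum _) (P := xpredT)
  (fun i _ => deriv_onM (hf (coord b i)) (hg (br b`_i))).
move/eq_deriv_on; apply => t _; first by rewrite [RHS]BE.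
by rewrite big_split /= !BE.
Qed.

(** Finite orders allow inductions, as for products or solutions of equations, which are awkward
    with the whole sequence of derivatives that [smooth_on] asks for at once. *)
Fixpoint Ck_on (W : vectType R) (n : nat) (f : R -> W) : Prop :=
  if n is m.+1 then exists g, has_deriv_on I f g /\ Ck_on m g else True.

Lemma eq_Ck_on (W : vectType R) n (f g : R -> W) :
  Ck_on n f -> (forall t, I t -> f t = g t) -> Ck_on n g.
Proof.
case: n => [|n] //= [h [hf ch]] fg; exists h; split=> //.
exact: eq_has_deriv_on hf fg _.
Qed.

Lemma Ck_on_leS (W : vectType R) n (f : R -> W) : Ck_on n.+1 f -> Ck_on n f.
Proof.
elim: n f => [|n IH] f // [g [hf /IH cg]]; by exists g.
Qed.

Lemma Ck_on_linear (W V : vectType R) (L : {linear W -> V}) n (f : R -> W) :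
  Ck_on n f -> Ck_on n (L \o f).
Proof.
elim: n f => [|n IH] f //= [g [hf /IH cg]].
by exists (L \o g); split=> //; exact: has_deriv_on_linear.
Qed.

Lemma Ck_onD (W : vectType R) n (f g : R -> W) :
  Ck_on n f -> Ck_on n g -> Ck_on n (fun t => f t + g t).
Proof.
elim: n f g => [|n IH] f g //= [f' [hf cf]] [g' [hg cg]].
by exists (fun t => f' t + g' t); split; [exact: has_deriv_onD|exact: IH].
Qed.

Lemma Ck_on0 (W : vectType R) n : Ck_on n (fun=> 0 : W).
Proof.
by elim: n => [|n IH] //; exists (fun=> 0); split=> //; exact: has_deriv_on0.
Qed.

Lemma Ck_on_sum (W : vectType R) n (T : Type) (r : seq T) (f : T -> R -> W) :
  (forall i, Ck_on n (f i)) -> Ck_on n (fun t => \sum_(i <- r) f i t).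
Proof.
move=> h; elim: r => [|i r IH].
  by apply: eq_Ck_on (Ck_on0 _ n) _ => t _; rewrite big_nil.
by apply: eq_Ck_on (Ck_onD (h i) IH) _ => t _; rewrite big_cons.
Qed.

Lemma Ck_onZ (W : vectType R) n (c : R -> R) (f : R -> W) :
  Ck_on n (c : R -> R^o) -> Ck_on n f -> Ck_on n (fun t => c t *: f t).
Proof.
elim: n c f => [|n IH] c f //.
move=> cc cf; have cc' := Ck_on_leS cc; have cf' := Ck_on_leS cf.
move: cc cf => [d [/has_deriv_onR hc cd]] [g [hf cg]].
exists (fun t => d t *: f t + c t *: g t); split.
  exact: has_deriv_onZ.
by apply: Ck_onD; apply: IH.
Qed.

(** For each n the definition of [Ck_on] supplies its own derivatives. They are determined on [I],
    so a single sequence built by choice has all the required properties. *)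
Lemma smooth_onP (W : vectType R) (f : R -> W) :
  smooth_on I f <-> forall n, Ck_on n f.
Proof.
split=> [[g [g0 hg]] n|h].
  suff H k : Ck_on n (g k) by apply: eq_Ck_on (H 0%N) g0.
  by elim: n k => [|n IH] k //; exists (g k.+1); split.
(* The default 0 is never returned along the iteration: [H] shows that each iterate has a
   derivative. *)
pose D (u : R -> W) := xget (fun=> 0) [set v | has_deriv_on I u v].
exists (fun n => iter n D f); split=> // n.
suff H k : Ck_on k.+1 (iter n D f).
  have [v [hv _]] := H 0%N; rewrite iterS {2}/D; case: xgetP => [u _ //|].
  by move=> /(_ v).
elim: n k => [|n IH] k //.
have [v [hv cv]] := IH k.+1; rewrite iterS {1}/D; case: xgetP => [u _ /= hu|].
  by apply: (@eq_Ck_on _ k.+1 v) => //; exact: has_deriv_on_unique hv hu.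
by move=> /(_ v).
Qed.

Lemma smooth_on_deriv (W : vectType R) (f g : R -> W) :
  smooth_on I f -> has_deriv_on I f g -> smooth_on I g.
Proof.
move=> /smooth_onP sf hf; apply/smooth_onP => n.
have [g' [hf' cg']] := sf n.+1.
by apply: (@eq_Ck_on _ n g') => //; exact: has_deriv_on_unique hf' hf.
Qed.

Lemma smooth_on_linear (W V : vectType R) (L : {linear W -> V}) (f : R -> W) :
  smooth_on I f -> smooth_on I (L \o f).
Proof.
by move=> /smooth_onP h; apply/smooth_onP => n; exact: Ck_on_linear.
Qed.

Lemma smooth_onD (W : vectType R) (f g : R -> W) :
  smooth_on I f -> smooth_on I g -> smooth_on I (fun t => f t + g t).
Proof.
by move=> /smooth_onP hf /smooth_onP hg; apply/smooth_onP => n; exact: Ck_onD.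
Qed.

Lemma smooth_on0 (W : vectType R) : smooth_on I (fun=> 0 : W).
Proof. by apply/smooth_onP => n; exact: Ck_on0. Qed.

Lemma smooth_on_cont (c : R -> R) : smooth_on I (c : R -> R^o) -> cont_on I c.
Proof.
by move=> /smooth_onP /(_ 1%N)[d [/has_deriv_onR /deriv_on_cont]].
Qed.

(** The coefficients are scalars, so the coordinates in a basis of W solve independent copies of one
    scalar system. Smoothness is a bootstrap: a solution of class n makes the right-hand side of
    class n, hence the solution of class n + 1. *)
Lemma linear_ode (W : vectType R) (T : finType) (A : T -> T -> R -> R)
    (t0 : R) (w : T -> W) :
  (forall i j, smooth_on I (A i j : R -> R^o)) -> I t0 ->
  exists u : T -> R -> W, [/\ forall i, u i t0 = w i,
    forall i, has_deriv_on I (u i) (fun t => \sum_j A i j t *: u j t)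
    & forall i, smooth_on I (u i)].
Proof.
move=> sA It0; pose b := vbasis {:W}.
have /choice[y hy] : forall k : 'I_(\dim {:W}), exists y : T -> R -> R,
    (forall i, y i t0 = coord b k (w i)) /\
    forall i, deriv_on I (y i) (fun t => \sum_j A i j t * y j t).
  move=> k; apply: (linear_ode_scalar (fun i => coord b k (w i)) hI) => // i j.
  exact: smooth_on_cont.
pose u i t := \sum_k y k i t *: b`_k.
have hu i : has_deriv_on I (u i) (fun t => \sum_j A i j t *: u j t).
  move=> phi; have := deriv_on_sum (r := index_enum _) (P := xpredT)
    (fun (k : 'I_(\dim {:W})) _ => @deriv_onZ _ _ (phi b`_k) _ _ ((hy k).2 i)).
  move/eq_deriv_on; apply => t _.
    by rewrite /u linear_sum; apply: eq_bigr => k _; rewrite linearZ mulrC.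
  rewrite linear_sum; under [RHS]eq_bigr do
    rewrite linearZ /u linear_sum /= mulr_sumr.
  rewrite exchange_big; apply: eq_bigr => k _; rewrite mulr_sumr.
  by apply: eq_bigr => j _; rewrite linearZ /=; ring.
exists u; split=> // i.
  by rewrite [RHS](coord_vbasis (memvf _)); apply: eq_bigr => k _; rewrite (hy k).1.
apply/smooth_onP => n; elim: n i => [|n IH] i //.
exists (fun t => \sum_j A i j t *: u j t); split=> //.
by apply: Ck_on_sum => j; apply: Ck_onZ => //; have /smooth_onP := sA i j.
Qed.

End VectorDerivatives.

Lemma has_deriv_on_subset (R : realType) (I J : set R) (W : vectType R)
    (f g : R -> W) : J `<=` I -> has_deriv_on I f g -> has_deriv_on J f g.
Proof. by move=> JI h phi; exact: deriv_on_subset JI (h phi). Qed.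

Lemma smooth_on_subset (R : realType) (I J : set R) (W : vectType R)
    (f : R -> W) : J `<=` I -> smooth_on I f -> smooth_on J f.
Proof.
move=> JI [g [g0 hg]]; exists g; split=> [t /JI|n]; first exact: g0.
exact: has_deriv_on_subset (hg n).
Qed.

Lemma eq_smooth_on (R : realType) (I : set R) (W : vectType R) (f g : R -> W) :
  smooth_on I f -> (forall t, I t -> f t = g t) -> smooth_on I g.
Proof.
by move=> [h [h0 hd]] fg; exists h; split=> // t It; rewrite h0 // fg.
Qed.

(** * Symplectic and Euclidean bases *)

Section FiniteFamilies.
Variables (K : fieldType) (W : vectType K) (S : finType) (u : S -> W).

Lemma mem_span_famP v :
  v \in <<[seq u x | x <- enum S]>>%VS <-> exists k : S -> K, v = \sum_x k x *: u x.
Proof.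
split=> [|[k ->]]; last first.
  apply: memv_suml => x _; apply/memvZ/memv_span/map_f; exact: mem_enum.
elim: (enum S) v => [|x s IH] v.
  rewrite span_nil memv0 => /eqP ->; exists (fun=> 0).
  by rewrite big1 // => x _; rewrite scale0r.
rewrite /= span_cons => /memv_addP[_ /vlineP[c ->]] [w /IH[k ->] ->].
exists (fun y => c * (y == x)%:R + k y).
under [RHS]eq_bigr do rewrite scalerDl; rewrite big_split /=; congr (_ + _).
rewrite (bigD1 x) //= eqxx mulr1 big1 ?addr0 // => y /negPf ->.
by rewrite mulr0 scale0r.
Qed.

Lemma free_famP : free [seq u x | x <- enum S] <->
  forall k : S -> K, \sum_x k x *: u x = 0 -> forall x, k x = 0.
Proof.
pose X := [tuple u (enum_val i) | i < #|S|].
have XE : [seq u x | x <- enum S] = X.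
  apply: (@eq_from_nth _ 0); first by rewrite size_map -cardE size_tuple.
  move=> i; rewrite size_map -cardE => iS; pose j := Ordinal iS.
  rewrite (nth_map (enum_val j)) -?cardE //.
  rewrite -[RHS]/(nth 0 X j) nth_mktuple; congr (u _).
  exact: esym (enum_val_nth _ j).
have sumE (k : S -> K) :
    \sum_(i < #|S|) k (enum_val i) *: X`_i = \sum_x k x *: u x.
  rewrite [RHS](reindex (@enum_val S S)) /=; last exact/onW_bij/enum_val_bij.
  by apply: eq_bigr => i _; rewrite nth_mktuple.
rewrite XE; split=> [/freeP h k k0 x|h].
  by rewrite -(enum_rankK x); apply: (h (k \o enum_val)); rewrite sumE.
apply/freeP => k k0 i; rewrite -(enum_valK i); apply: (h (k \o enum_rank)).
by rewrite -sumE -[RHS]k0; apply: eq_bigr => j _ /=; rewrite enum_valK.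
Qed.

Lemma full_famP : free [seq u x | x <- enum S] -> #|S| = \dim {: W} ->
  forall v, exists k : S -> K, v = \sum_x k x *: u x.
Proof.
move=> fu cS v; apply/mem_span_famP.
suff /eqP -> : <<[seq u x | x <- enum S]>>%VS == fullv by exact: memvf.
rewrite eqEdim subvf /= -cS (eqnP fu) size_map -cardE //.
Qed.

Lemma full_fam_free : (forall v, exists k : S -> K, v = \sum_x k x *: u x) ->
  #|S| = \dim {: W} -> free [seq u x | x <- enum S].
Proof.
move=> h cS; rewrite /free size_map -cardE cS; apply/eqP; congr (\dim _).
by apply/vspaceP => v; rewrite memvf; apply/mem_span_famP.
Qed.

End FiniteFamilies.

Section SymplecticSpace.
Variables (R : realType) (W : vectType R) (omega : {skew_symmetric W}).

Lemma omega_scalarr u : scalar (omega u).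
Proof. by move=> a v w; rewrite linearP. Qed.

Lemma omega_scalarl v : scalar (omega^~ v).
Proof. by move=> a u w; rewrite linearDl linearZl_LR. Qed.

Lemma omegaC u v : omega u v = - omega v u.
Proof. by rewrite hermC expr1 mulN1r. Qed.

Lemma omega_self u : omega u u = 0.
Proof. have := omegaC u u; lra. Qed.

Lemma omegaZl a u v : omega (a *: u) v = a * omega u v.
Proof. exact: linearZl_LR. Qed.

Lemma omegaZr a u v : omega u (a *: v) = a * omega u v.
Proof. by rewrite linearZ. Qed.

Lemma omegaDl u v w : omega (u + v) w = omega u w + omega v w.
Proof. exact: linearDl. Qed.

Lemma omegaDr u v w : omega w (u + v) = omega w u + omega w v.
Proof. exact: linearDr. Qed.

Lemma omegaNl u v : omega (- u) v = - omega u v.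
Proof. exact: linearNl. Qed.

Lemma omegaNr u v : omega v (- u) = - omega v u.
Proof. exact: linearNr. Qed.

Lemma omega0l u : omega 0 u = 0.
Proof. exact: linear0l. Qed.

Lemma omega0r u : omega u 0 = 0.
Proof. exact: linear0r. Qed.

Lemma omega_suml (T : Type) (r : seq T) (P : pred T) (F : T -> W) v :
  omega (\sum_(i <- r | P i) F i) v = \sum_(i <- r | P i) omega (F i) v.
Proof. exact: linear_sumlz. Qed.

Lemma omega_sumr (T : Type) (r : seq T) (P : pred T) (F : T -> W) v :
  omega v (\sum_(i <- r | P i) F i) = \sum_(i <- r | P i) omega v (F i).
Proof. exact: linear_sumr. Qed.

Lemma nondegenerate_neq0 v : nondegenerate omega -> v != 0 ->
  exists w, omega w v != 0.
Proof.
move=> /eqP n v0; apply: contra_notP (elimN eqP v0) => h.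
apply/eqP; rewrite -memv0 -n; apply/mem_orthovP => w _.
rewrite omegaC; apply/eqP; rewrite oppr_eq0; apply/negPn/negP => wv.
by apply: h; exists w.
Qed.

Section Families.
Variables (T : finType).
Implicit Types e f : T -> W.

Definition symplectic_family e f : Prop := forall x y,
  [/\ omega (e x) (e y) = 0, omega (f x) (f y) = 0
    & omega (f x) (e y) = (x == y)%:R].

Definition expansion e1 f1 e2 f2 (v : W) : W :=
  \sum_x (omega (f1 x) v *: e2 x - omega (e1 x) v *: f2 x).

Definition pair_family e f (x : T + T) : W :=
  match x with inl x => e x | inr x => f x end.

Lemma sum_pair_family e f (k : T + T -> R) :
  \sum_x k x *: pair_family e f x =
  \sum_x (k (inl x) *: e x + k (inr x) *: f x).
Proof. by rewrite big_sumType /= big_split. Qed.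

Lemma symplectic_family_coef e f (a b : T -> R) : symplectic_family e f ->
  let v := \sum_x (a x *: e x + b x *: f x) in
  forall x, omega (f x) v = a x /\ omega (e x) v = - b x.
Proof.
move=> h v x; have [_ h2 h3] := h x x; split.
  rewrite omega_sumr (bigD1 x) //= big1 => [|y yx].
    by rewrite omegaDr !omegaZr h2 h3 eqxx /=; ring.
  have [h4 h5 h6] := h x y.
  by rewrite omegaDr !omegaZr h5 h6 eq_sym (negPf yx) /=; ring.
rewrite omega_sumr (bigD1 x) //= big1 => [|y yx].
  by rewrite omegaDr !omegaZr omega_self omegaC h3 eqxx /=; ring.
have [h4 h5 _] := h x y; have [_ _ h6] := h y x.
by rewrite omegaDr !omegaZr h4 omegaC h6 (negPf yx) /=; ring.
Qed.

Lemma symplectic_family_free e f : symplectic_family e f ->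
  free [seq pair_family e f x | x <- enum {: T + T}].
Proof.
move=> h; apply/free_famP => k; rewrite sum_pair_family => k0.
have := symplectic_family_coef (fun x => k (inl x)) (fun x => k (inr x)) h.
rewrite k0 /= => H [x|x]; have [h1 h2] := H x.
  by rewrite -h1 omega0r.
by move: h2; rewrite omega0r => /esym/eqP; rewrite oppr_eq0 => /eqP.
Qed.

Lemma symplectic_family_freel e f : symplectic_family e f ->
  free [seq e x | x <- enum T].
Proof.
move=> h; apply/free_famP => k k0 x.
have [<- _] := symplectic_family_coef k (fun=> 0) h x.
rewrite (eq_bigr (fun x => k x *: e x)) ?k0 ?omega0r // => y _.
by rewrite scale0r addr0.
Qed.

Lemma symplectic_family_expansion e f : symplectic_family e f ->
  \dim {: W} = (2 * #|T|)%N -> forall v, expansion e f e f v = v.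
Proof.
move=> h dW v; have cT : #|{: T + T}| = \dim {: W}.
  by rewrite card_sum dW mul2n addnn.
have [k] := full_famP (symplectic_family_free h) cT v.
rewrite sum_pair_family => E.
rewrite [RHS]E /expansion; apply: eq_bigr => x _.
have := symplectic_family_coef (fun x => k (inl x)) (fun x => k (inr x)) h.
by rewrite -E => /= /(_ x)[-> ->]; rewrite scaleNr opprK.
Qed.

(** The hypothesis makes the family spanning, hence free by dimension. The values of [omega] are
    then the unique coefficients of a vector, and reading them off for e y and f y gives the Darboux
    relations. *)
Lemma expansion_symplectic_family e f : (forall v, expansion e f e f v = v) ->
  \dim {: W} = (2 * #|T|)%N -> symplectic_family e f.
Proof.
move=> h dW; have cT : #|{: T + T}| = \dim {: W}.
  by rewrite card_sum dW mul2n addnn.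
have fr : free [seq pair_family e f x | x <- enum {: T + T}].
  apply: full_fam_free cT => v.
  exists (fun x => match x with
    | inl x => omega (f x) v | inr x => - omega (e x) v end).
  rewrite sum_pair_family -[LHS]h; apply: eq_bigr => x _.
  by rewrite scaleNr.
have key (a b : T -> R) : \sum_x (a x *: e x + b x *: f x) = 0 ->
    forall x, a x = 0 /\ b x = 0.
  move=> ab0 x; move/free_famP: fr => /(_ (fun x => match x with
    inl x => a x | inr x => b x end)); rewrite sum_pair_family => /(_ ab0) H.
  by split; [exact: (H (inl x))|exact: (H (inr x))].
have coef v (a b : T -> R) : v = \sum_x (a x *: e x + b x *: f x) ->
    forall x, omega (f x) v = a x /\ omega (e x) v = - b x.
  move=> vE x.
  have /key/(_ x)[h1 h2] : \sum_x ((omega (f x) v - a x) *: e x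
      + (- omega (e x) v - b x) *: f x) = 0.
    rewrite -[RHS](subrr v) -[X in X - _]h [X in _ - X]vE -sumrB.
    apply: eq_bigr => y _.
    by rewrite !scalerBl scaleNr opprD addrACA.
  by split; [apply/eqP; rewrite -subr_eq0 h1|apply: oppr_inj; rewrite opprK;
    apply/eqP; rewrite -subr_eq0 h2].
have eE y : e y = \sum_x ((x == y)%:R *: e x + 0 *: f x).
  rewrite (bigD1 y) //= eqxx scale1r scale0r addr0 big1 ?addr0 // => x /negPf ->.
  by rewrite !scale0r addr0.
have fE y : f y = \sum_x (0 *: e x + (x == y)%:R *: f x).
  rewrite (bigD1 y) //= eqxx scale1r scale0r add0r big1 ?addr0 // => x /negPf ->.
  by rewrite !scale0r addr0.
move=> x y; have [h1 h2] := coef _ _ _ (eE y) x.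
have [h3 _] := coef _ _ _ (fE y) x.
by split=> //; rewrite h2 oppr0.
Qed.

End Families.

(** Symplectic Gram-Schmidt: a pair is added to the family inside the orthogonal of its span. *)
Lemma symplectic_basis_exists (T : finType) : nondegenerate omega ->
  \dim {: W} = (2 * #|T|)%N -> exists e f : T -> W, symplectic_family e f.
Proof.
move=> nd dW; suff H k : (k <= #|T|)%N ->
    exists e f : 'I_k -> W, symplectic_family e f.
  have [e [f h]] := H _ (leqnn #|T|).
  exists (e \o enum_rank), (f \o enum_rank) => x y /=.
  by have := h (enum_rank x) (enum_rank y); rewrite (inj_eq enum_rank_inj).
elim: k => [|k IH] kT; first by exists (fun=> 0), (fun=> 0) => -[].
have [e [f h]] := IH (ltnW kT).
(* Otherwise the 2k vectors of the family would span W, whose dimension is at least 2k + 2. *)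
have [v vP] : exists v, v != expansion e f e f v.
  have [//|nv] := pselect (exists v, v != expansion e f e f v).
  have : (\dim {: W} <= 2 * k)%N.
    pose X := [seq pair_family e f x | x <- enum {: 'I_k + 'I_k}].
    have full v : v \in <<X>>%VS.
      apply/mem_span_famP.
      exists (fun x => match x with
        | inl x => omega (f x) v | inr x => - omega (e x) v end).
      rewrite sum_pair_family; apply/eqP/negP => /negP vE; apply: nv; exists v.
      by apply: contra vE => /eqP {1}->; apply/eqP/eq_bigr => x _; rewrite scaleNr.
    apply: (@leq_trans (\dim <<X>>)).
      by apply: dimvS; apply/subvP => v _; exact: full.
    apply: leq_trans (dim_span _) _.
    by rewrite size_map -cardE card_sum card_ord addnn mul2n.
  by rewrite dW leq_mul2l /= leqNgt kT.
have orth w : forall x, omega (f x) (w - expansion e f e f w) = 0 /\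
    omega (e x) (w - expansion e f e f w) = 0.
  move=> x; have := symplectic_family_coef (fun x => omega (f x) w)
    (fun x => - omega (e x) w) h.
  have -> : \sum_x (omega (f x) w *: e x + - omega (e x) w *: f x) =
      expansion e f e f w by apply: eq_bigr => y _; rewrite scaleNr.
  move=> /= /(_ x)[h1 h2]; rewrite !omegaDr !omegaNr h1 h2 opprK.
  by rewrite !subrr.
pose v' := v - expansion e f e f v.
have v'0 : v' != 0 by rewrite subr_eq0.
have [w wv'] := nondegenerate_neq0 nd v'0.
(* Subtracting the expansion of w does not change its pairing with v', which is orthogonal to the
   family. *)
pose w' := (omega w v')^-1 *: (w - expansion e f e f w).
have w'v' : omega w' v' = 1.
  rewrite omegaZl omegaDl omegaNl {2}/v' omega_suml big1 ?subr0 ?mulVf //.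
  move=> x _; have [h1 h2] := orth v x.
  by rewrite omegaDl omegaNl !omegaZl h1 h2; ring.
have ow' x : omega (f x) w' = 0 /\ omega (e x) w' = 0.
  by have [h1 h2] := orth w x; rewrite !omegaZr h1 h2 mulr0.
pose ext (g : 'I_k -> W) z (i : 'I_k.+1) := if unlift ord_max i is Some j then g j else z.
exists (ext e v'), (ext f w') => x y; rewrite /ext.
have flip a b : omega b a = 0 -> omega a b = 0.
  by move=> ba; rewrite omegaC ba oppr0.
case: unliftP => [i ->|->]; case: unliftP => [j ->|->]; rewrite ?eqxx.
- by have [h1 h2 h3] := h i j; rewrite (inj_eq lift_inj).
- have [h1 h2] := orth v i; have [h3 h4] := ow' i.
  by rewrite h1 h2 h3 eq_sym (negPf (neq_lift _ _)).
- have [h1 h2] := orth v j; have [h3 h4] := ow' j.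
  split; try exact: flip.
  by rewrite (negPf (neq_lift _ _)); exact: flip.
- by rewrite !omega_self w'v'.
Qed.

End SymplecticSpace.

Section EuclideanSpace.
Variables (R : realType) (V : euclidean_space R).

Lemma orthonormal_family_exists n : (n <= \dim {: V})%N ->
  exists b : 'I_n -> V, forall i j, inner V (b i) (b j) = (i == j)%:R.
Proof.
elim: n => [|n IH] nV; first by exists (fun=> 0) => -[].
have [b hb] := IH (ltnW nV).
have ic u v : inner V u v = inner V v u by rewrite hermC expr0 mul1r.
pose p (v : V) := \sum_i inner V v (b i) *: b i.
have [v vP] : exists v, v != p v.
  have [//|nv] := pselect (exists v, v != p v).
  have : (\dim {: V} <= n)%N.
    apply: (@leq_trans (\dim <<[seq b x | x <- enum 'I_n]>>)).
      apply: dimvS; apply/subvP => v _; apply/mem_span_famP.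
      exists (fun i => inner V v (b i)).
      by apply/eqP/negP => /negP vE; apply: nv; exists v.
    by apply: leq_trans (dim_span _) _; rewrite size_map -cardE card_ord.
  by rewrite leqNgt nV.
pose w := v - p v; have w0 : w != 0 by rewrite subr_eq0.
have wb i : inner V w (b i) = 0.
  rewrite linearDl linearNl linear_sumlz (bigD1 i) //= linearZl_LR /= hb eqxx.
  rewrite mulr1 big1 ?addr0 ?subrr // => j ji.
  by rewrite linearZl_LR /= hb (negPf ji) mulr0.
have ww : 0 < inner V w w by exact: neq0_dnorm_gt0.
pose w' := (Num.sqrt (inner V w w))^-1 *: w.
have w'b i : inner V w' (b i) = 0 by rewrite linearZl_LR /= wb mulr0.
have w'w' : inner V w' w' = 1.
  rewrite linearZl_LR linearZ /= mulrA -invfM -expr2 sqr_sqrtr ?ltW //.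
  by rewrite mulVf // gt_eqF.
exists (fun i => if unlift ord_max i is Some j then b j else w') => x y.
case: unliftP => [i ->|->]; case: unliftP => [j ->|->]; rewrite ?eqxx //.
- by rewrite hb (inj_eq lift_inj).
- by rewrite ic w'b eq_sym (negPf (neq_lift _ _)).
- by rewrite w'b (negPf (neq_lift _ _)).
Qed.

Lemma orthonormal_expansion n (b : 'I_n -> V) : \dim {: V} = n ->
  (forall i j, inner V (b i) (b j) = (i == j)%:R) ->
  forall v, v = \sum_i inner V v (b i) *: b i.
Proof.
move=> dV hb.
have coef (k : 'I_n -> R) i : inner V (\sum_j k j *: b j) (b i) = k i.
  rewrite linear_sumlz (bigD1 i) //= linearZl_LR /= hb eqxx.
  rewrite mulr1 big1 ?addr0 // => j ji.
  by rewrite linearZl_LR /= hb (negPf ji) mulr0.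
have fr : free [seq b i | i <- enum 'I_n].
  by apply/free_famP => k k0 i; rewrite -coef k0 linear0l.
move=> v; have [k ->] := full_famP fr (etrans (card_ord _) (esym dV)) v.
by apply: eq_bigr => i _; rewrite coef.
Qed.

End EuclideanSpace.

(** * Structure equations *)

Section Boxes.
Variable D : young_diagram.

Definition box_left (x : box D) : box D :=
  @mkbox D (superbox_left (tag x)) (tagged x).
Definition box_right (x : box D) : box D :=
  @mkbox D (superbox_right (tag x)) (tagged x).
Definition box_col (x : box D) : nat := superbox_col (tag x).

Lemma superbox_col_right (a : superbox D) : ~~ special a ->
  superbox_col (superbox_right a) = (superbox_col a).+1.
Proof.
move=> sa; rewrite /superbox_right /superbox_col /= val_insubd.
have := ltn_ord (tagged a); move: sa; rewrite /special /superbox_col.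
by rewrite leq_eqVlt => /negPf -> /= ->.
Qed.

Lemma superbox_col_left (a : superbox D) :
  superbox_col (superbox_left a) = (superbox_col a).-1.
Proof.
rewrite /superbox_left /superbox_col /= val_insubd.
by rewrite (leq_ltn_trans (leq_pred _) (ltn_ord _)).
Qed.

Lemma superbox_right_special (a : superbox D) : special a -> superbox_right a = a.
Proof.
case: a => i k; rewrite /special /superbox_right /superbox_col /= => /eqP sk.
by congr Tagged; apply: val_inj; rewrite val_insubd sk ltnn.
Qed.

Lemma superbox_rightK (a : superbox D) : ~~ special a ->
  superbox_left (superbox_right a) = a.
Proof.
move=> sa; have := superbox_col_left (superbox_right a).
rewrite superbox_col_right //=; case: a sa => i k sa h.
by congr Tagged; exact: val_inj.
Qed.

Lemma superbox_leftK (a : superbox D) : ~~ in_first_column a ->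
  superbox_right (superbox_left a) = a.
Proof.
move=> fa; have sa : ~~ special (superbox_left a).
  rewrite /special superbox_col_left prednK ?lt0n //.
  by case: a {fa} => i k /=; rewrite /superbox_col /= neq_ltn ltn_ord.
have := superbox_col_right sa; rewrite superbox_col_left prednK ?lt0n //.
case: a {sa} fa => i k fa h.
by congr Tagged; exact: val_inj.
Qed.

(** The rank k of a box has a type that depends on the level alone, so boxes of one level and rank
    are compared through their column numbers, without transport. *)
Lemma eq_mkbox (i : level D) (c c' : 'I_(level_length i))
    (k : 'I_(level_mult i)) : c = c' :> nat ->
  @mkbox D (Tagged (fun i => 'I_(level_length i)) c) k =
  @mkbox D (Tagged (fun i => 'I_(level_length i)) c') k.
Proof. by move=> cc; have -> : c = c' by exact: val_inj. Qed.

Lemma box_rightK (x : box D) : ~~ special (tag x) -> box_left (box_right x) = x.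
Proof.
case: x => -[i c] k sx; apply: eq_mkbox.
exact: (congr1 (@superbox_col D) (superbox_rightK sx)).
Qed.

Lemma box_leftK (x : box D) : ~~ in_first_column (tag x) ->
  box_right (box_left x) = x.
Proof.
case: x => -[i c] k fx; apply: eq_mkbox.
exact: (congr1 (@superbox_col D) (superbox_leftK fx)).
Qed.

Lemma box_right_special (x : box D) : special (tag x) -> box_right x = x.
Proof.
case: x => -[i c] k sx; apply: eq_mkbox.
exact: (congr1 (@superbox_col D) (superbox_right_special sx)).
Qed.

Lemma sum_box_shift (V : nmodType) (G : box D -> box D -> V) :
  \sum_(x | ~~ special (tag x)) G (box_right x) x =
  \sum_(x | ~~ in_first_column (tag x)) G x (box_left x).
Proof.
rewrite [RHS](reindex_onto box_right box_left) => [|x /box_leftK //].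
apply: eq_big => [x|x sx]; last by rewrite box_rightK.
have [sx|sx] := boolP (special (tag x)); last first.
  rewrite box_rightK // eqxx andbT /in_first_column.
  by rewrite [superbox_col _](superbox_col_right sx).
(* [box_right] fixes a special box; such a box must not be counted on the other side, and indeed it
   is in the first column or is moved by [box_left]. *)
rewrite box_right_special //; apply/esym/negbTE; rewrite negb_and negbK.
rewrite -implyNb; apply/implyP => fx; apply/eqP => lx.
have := superbox_col_left (tag x); rewrite -[superbox_left _]/(tag (box_left x)).
rewrite lx => /eqP; rewrite eq_sym; apply/negP.
by rewrite -lt0n in fx; rewrite neq_ltn prednK ?leqnn.
Qed.

Lemma sum_box (V : nmodType) (F : forall a : superbox D, 'I_(superbox_size a) -> V) :
  \sum_(a : superbox D) \sum_(k < superbox_size a) F a k =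
  \sum_(x : box D) F (tag x) (tagged x).
Proof. by rewrite sig_big_dep. Qed.

End Boxes.

Section StructureEquations.
Variables (R : realType) (D : young_diagram) (W : vectType R).
Implicit Types (Rm : compatible_mapping R D) (e f : box D -> W).

(** The coefficient of e y in the derivative of f x; rows of the matrix belong to the target. *)
Definition mapping_entry Rm (x y : box D) : R :=
  Rm (tag x) (tag y) (tagged y) (tagged x).

Definition frame_de e f (x : box D) : W :=
  if in_first_column (tag x) then f x else e (box_left x).

Definition frame_df Rm e f (x : box D) : W :=
  \sum_y mapping_entry Rm x y *: e y
  - (if special (tag x) then 0 else f (box_right x)).

Lemma mapping_entry_sym Rm x y : symmetric_mapping Rm ->
  mapping_entry Rm x y = mapping_entry Rm y x.
Proof. by move=> sR; rewrite /mapping_entry (sR (tag x) (tag y)) mxE. Qed.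

(** The sum is the derivative of the expansion of v. The curvature terms cancel by symmetry ([A]).
    The shift terms are summed by parts ([B], [C]), with boundary terms on the first column that are
    the same in both and cancel as well. *)
Lemma expansion_deriv0 (omega : {skew_symmetric W}) Rm e1 f1 e2 f2 v :
  symmetric_mapping Rm ->
  \sum_x ((omega (frame_df Rm e1 f1 x) v *: e2 x
            + omega (f1 x) v *: frame_de e2 f2 x)
          - (omega (frame_de e1 f1 x) v *: f2 x
            + omega (e1 x) v *: frame_df Rm e2 f2 x)) = 0.
Proof.
move=> sR.
pose E1 x := \sum_y mapping_entry Rm x y *: e1 y.
pose E2 x := \sum_y mapping_entry Rm x y *: e2 y.
pose H1 x := if special (tag x) then 0 else f1 (box_right x).
pose H2 x := if special (tag x) then 0 else f2 (box_right x).
have A : \sum_x omega (E1 x) v *: e2 x = \sum_x omega (e1 x) v *: E2 x.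
  under eq_bigr do rewrite omega_suml scaler_suml.
  rewrite exchange_big; apply: eq_bigr => x _ /=.
  rewrite scaler_sumr; apply: eq_bigr => y _.
  by rewrite omegaZl scalerA mulrC mapping_entry_sym.
have B : \sum_x omega (H1 x) v *: e2 x + \sum_(x | in_first_column (tag x))
    omega (f1 x) v *: f2 x = \sum_x omega (f1 x) v *: frame_de e2 f2 x.
  rewrite [RHS](bigID (fun x => in_first_column (tag x))) /= [LHS]addrC; congr (_ + _).
    by apply: eq_bigr => x; rewrite /frame_de => ->.
  rewrite (bigID (fun x => special (tag x))) /= big1 ?add0r => [|x sx]; last first.
    by rewrite /H1 sx omega0l scale0r.
  rewrite [RHS](eq_bigr (fun x => omega (f1 x) v *: e2 (box_left x))) => [|x].
    rewrite -(sum_box_shift (fun x y => omega (f1 x) v *: e2 y)).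
    by apply: eq_bigr => x; rewrite /H1 => /negPf ->.
  by rewrite /frame_de => /negPf ->.
have C : \sum_x omega (e1 x) v *: H2 x + \sum_(x | in_first_column (tag x))
    omega (f1 x) v *: f2 x = \sum_x omega (frame_de e1 f1 x) v *: f2 x.
  rewrite [RHS](bigID (fun x => in_first_column (tag x))) /= [LHS]addrC; congr (_ + _).
    by apply: eq_bigr => x; rewrite /frame_de => ->.
  rewrite (bigID (fun x => special (tag x))) /= big1 ?add0r => [|x sx]; last first.
    by rewrite /H2 sx scaler0.
  rewrite [RHS](eq_bigr (fun x => omega (e1 (box_left x)) v *: f2 x)) => [|x].
    rewrite -(sum_box_shift (fun x y => omega (e1 y) v *: f2 x)).
    by apply: eq_bigr => x; rewrite /H2 => /negPf ->.
  by rewrite /frame_de => /negPf ->.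
rewrite sumrB !big_split /= -B -C.
have -> : \sum_x omega (frame_df Rm e1 f1 x) v *: e2 x =
    \sum_x omega (E1 x) v *: e2 x - \sum_x omega (H1 x) v *: e2 x.
  rewrite -sumrB; apply: eq_bigr => x _.
  by rewrite /frame_df omegaDl omegaNl scalerBl.
have -> : \sum_x omega (e1 x) v *: frame_df Rm e2 f2 x =
    \sum_x omega (e1 x) v *: E2 x - \sum_x omega (e1 x) v *: H2 x.
  by rewrite -sumrB; apply: eq_bigr => x _; rewrite /frame_df scalerBr.
rewrite A; set a := \sum_x _; set b := \sum_x _; set c := \sum_(x | _) _.
set d := \sum_x _.
by rewrite [a - b + _]addrA subrK [d + c + _]addrC [a - d + _]addrA subrK subrr.
Qed.

End StructureEquations.

Section Frames.
Variables (R : realType) (D : young_diagram) (I : set R).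
Hypotheses (hI : is_interval I) (hI2 : exists s t : R, [/\ I s, I t & s < t]).
Variables (W : vectType R) (omega : {skew_symmetric W}).
Implicit Types (e f : box D -> R -> W) (Rt : R -> compatible_mapping R D).

Definition structure_equations Rt e f : Prop := forall x,
  has_deriv_on I (e x) (fun t => frame_de (e^~ t) (f^~ t) x) /\
  has_deriv_on I (f x) (fun t => frame_df (Rt t) (e^~ t) (f^~ t) x).

Lemma has_deriv_on0_cst (f : R -> W) : has_deriv_on I f (fun=> 0) ->
  forall s t, I s -> I t -> f s = f t.
Proof.
move=> h s t Is It.
rewrite (coord_vbasis (memvf (f s))) (coord_vbasis (memvf (f t))).
apply: eq_bigr => i _; congr (_ *: _).
have h0 : deriv_on I (coord (vbasis {:W}) i \o f) (fun=> 0).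
  by apply: (eq_deriv_on (h (coord (vbasis {:W}) i))) => // u _; rewrite linear0.
exact: (deriv_on0_cst hI h0 Is It).
Qed.

Lemma deriv_on_omega (f f' g g' : R -> W) :
  has_deriv_on I f f' -> has_deriv_on I g g' ->
  deriv_on I (fun t => omega (f t) (g t))
    (fun t => omega (f' t) (g t) + omega (f t) (g' t)).
Proof.
by move=> hf hg; apply: deriv_on_bilinear hf hg;
  [exact: omega_scalarl|exact: omega_scalarr].
Qed.

Lemma has_deriv_on_cst (v : W) : has_deriv_on I (fun=> v) (fun=> 0).
Proof.
by move=> phi; apply: (eq_deriv_on (@deriv_on_cst _ _ (phi v))) => // t _;
  rewrite linear0.
Qed.

(* For two Darboux frames, the expansion is the map carrying the first one to
   the second. For twice the same frame, it is the identity at all times as soon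
   as it is at one time, hence the Darboux relations propagate. *)
Lemma expansion_constant Rt e1 f1 e2 f2 v :
  (forall t, I t -> symmetric_mapping (Rt t)) ->
  structure_equations Rt e1 f1 -> structure_equations Rt e2 f2 ->
  forall s t, I s -> I t ->
    expansion omega (e1^~ s) (f1^~ s) (e2^~ s) (f2^~ s) v =
    expansion omega (e1^~ t) (f1^~ t) (e2^~ t) (f2^~ t) v.
Proof.
move=> sR h1 h2; apply: has_deriv_on0_cst.
have dv g g' : has_deriv_on I g g' ->
    deriv_on I (fun t => omega (g t) v) (fun t => omega (g' t) v).
  move=> hg; apply: (eq_deriv_on (deriv_on_omega hg (has_deriv_on_cst v))) => // t _.
  by rewrite omega0r addr0.
apply: (eq_has_deriv_on (has_deriv_on_sum (r := index_enum _) (fun x =>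
  has_deriv_onD (has_deriv_onZ (dv _ _ (h1 x).2) (h2 x).1)
    (has_deriv_onN (has_deriv_onZ (dv _ _ (h1 x).1) (h2 x).2))))) => // t It.
exact: (expansion_deriv0 _ _ _ _ _ _ (sR t It)).
Qed.

Lemma structure_equations_exist Rt (t0 : R) (w1 w2 : box D -> W) : I t0 ->
  (forall x y, smooth_on I ((fun t => mapping_entry (Rt t) x y) : R -> R^o)) ->
  exists e f, [/\ structure_equations Rt e f,
    forall x, smooth_on I (e x) /\ smooth_on I (f x)
    & forall x, e x t0 = w1 x /\ f x t0 = w2 x].
Proof.
move=> It0 sR.
(* Rows and columns [inl x] stand for e x, [inr x] for f x; the booleans, read as 0 or 1, select the
   shifted box. *)
pose A (i j : box D + box D) (t : R) : R := match i, j with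
  | inl x, inl y => (~~ in_first_column (tag x) && (y == box_left x))%:R
  | inl x, inr y => (in_first_column (tag x) && (y == x))%:R
  | inr x, inl y => mapping_entry (Rt t) x y
  | inr x, inr y => - (~~ special (tag x) && (y == box_right x))%:R
  end.
have scst (c : R) : smooth_on I ((fun=> c) : R -> R^o).
  apply/(smooth_onP hI hI2) => n; case: n => [|n] //.
  exists (fun=> 0); split; last exact: Ck_on0.
  by apply/has_deriv_onR; exact: deriv_on_cst.
have sA i j : smooth_on I (A i j : R -> R^o).
  case: i => i; case: j => j /=; by [exact: scst | exact: sR].
have [u [u0 hu su]] := linear_ode hI hI2 (pair_family w1 w2) sA It0.
have pick1 (b : bool) (z : box D) (g : box D -> W) :
    \sum_y (b && (y == z))%:R *: g y = if b then g z else 0.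
  case: b; last by rewrite big1 // => y _; rewrite scale0r.
  rewrite (bigD1 z) //= eqxx scale1r big1 ?addr0 // => y /negPf ->.
  by rewrite scale0r.
exists (fun x => u (inl x)), (fun x => u (inr x)); split.
- move=> x; split; apply: (eq_has_deriv_on (hu _)) => // t _;
    rewrite big_sumType /=.
    by rewrite !pick1 /frame_de; case: (in_first_column _);
      rewrite ?add0r ?addr0.
  rewrite /frame_df; congr (_ + _).
  under eq_bigr do rewrite scaleNr.
  by rewrite sumrN pick1; case: (special _).
- by [].
- by move=> x; rewrite !u0.
Qed.

(** The left-hand side is the last clause of [normal_frame] word for word; the other side replaces
    its four cases by one equation per vector. *)
Lemma normal_frame_equationsP e f Rt :
  (forall (a : superbox D) (k : 'I_(superbox_size a)),
      let ER t := \sum_(b : superbox D) \sum_(m < superbox_size b)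
                    Rt t a b m k *: e (mkbox m) t in
      [/\ ~~ in_first_column a ->
            has_deriv_on I (e (mkbox k)) (e (@mkbox D (superbox_left a) k)),
          in_first_column a ->
            has_deriv_on I (e (mkbox k)) (f (mkbox k)),
          ~~ special a ->
            has_deriv_on I (f (mkbox k))
              (fun t => ER t - f (@mkbox D (superbox_right a) k) t)
        & special a -> has_deriv_on I (f (mkbox k)) ER])
  <-> structure_equations Rt e f.
Proof.
have E t a (k : 'I_(superbox_size a)) :
    \sum_(b : superbox D) \sum_(m < superbox_size b)
                    Rt t a b m k *: e (mkbox m) t =
    \sum_y mapping_entry (Rt t) (mkbox k) y *: e y t.
  rewrite (sum_box (fun b m => Rt t a b m k *: e (mkbox m) t)).
  by apply: eq_bigr => -[].
split=> [h [a k]|h a k ER].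
  have [h1 h2 h3 h4] := h a k; rewrite /frame_de /frame_df; split => /=.
    have [c|c] := boolP (in_first_column a).
      by apply: (eq_has_deriv_on (h2 c)) => // t _ /=; rewrite c.
    by apply: (eq_has_deriv_on (h1 c)) => // t _ /=; rewrite (negPf c).
  have [c|c] := boolP (special a).
    by apply: (eq_has_deriv_on (h4 c)) => // t _ /=; rewrite E subr0.
  by apply: (eq_has_deriv_on (h3 c)) => // t _ /=; rewrite E.
have [h1 h2] := h (mkbox k); rewrite /frame_de /frame_df /= in h1 h2.
split=> [/negPf fa|fa|/negPf sa|sa].
- by apply: (eq_has_deriv_on h1) => // t _; rewrite fa.
- by apply: (eq_has_deriv_on h1) => // t _; rewrite fa.
- by apply: (eq_has_deriv_on h2) => // t _; rewrite sa /ER E.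
- by apply: (eq_has_deriv_on h2) => // t _; rewrite sa /ER E subr0.
Qed.

Lemma normal_frame_exists Rt : nondegenerate omega ->
  \dim {: W} = (2 * nb_boxes D)%N ->
  (forall t, I t -> normal_mapping (Rt t)) ->
  (forall x y, smooth_on I ((fun t => mapping_entry (Rt t) x y) : R -> R^o)) ->
  exists e f,
    normal_frame I omega (fun t => <<[seq e x t | x <- enum (box D)]>>%VS) e f Rt.
Proof.
move=> nd dW nR sR; have [t0 [_ [It0 _ _]]] := hI2.
rewrite -card_box in dW; have [w1 [w2 w12]] := symplectic_basis_exists nd dW.
have [e [f [ef sm ef0]]] := structure_equations_exist w1 w2 It0 sR.
exists e, f; split=> //; last exact/normal_frame_equationsP.
move=> t It; apply: (expansion_symplectic_family _ dW) => v.
rewrite (expansion_constant v _ ef ef It It0); last first.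
  by move=> s Is; have [[]] := nR s Is.
rewrite -[RHS](symplectic_family_expansion w12 dW).
by apply: eq_bigr => x _; have [-> ->] := ef0 x.
Qed.

End Frames.

(** * Curves spanned by normal frames *)

Section ColumnCount.
Variable D : young_diagram.

(** Rows are grouped by length: a level longer than c has exactly one superbox in column c, and its
    size is the number of rows of that length. *)
Lemma column_sizeE c : column_size D c = \sum_(x : box D | box_col x == c) 1.
Proof.
rewrite big_mkcond (eq_bigr (fun x : box D => (box_col x == c : nat))) => [|x _];
  last by case: (_ == _).
rewrite -(sum_box (fun (a : superbox D) (k : 'I_(superbox_size a)) =>
  (superbox_col a == c : nat))).
rewrite (eq_bigr (fun a : superbox D =>
  (level_mult (tag a) * (superbox_col a == c))%N)) => [|a _]; last first.
  by rewrite sum_nat_const card_ord.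
rewrite (eq_bigl (fun a : superbox D => true && true)) //.
rewrite -(@sig_big_dep _ _ _ _ _ xpredT (fun=> xpredT)
  (fun i (j : 'I_(level_length i)) => level_mult i * (nat_of_ord j == c))%N) /=.
have -> : column_size D c =
    (\sum_(p <- undup D) (c < p) * count_mem p D)%N.
  rewrite /column_size -sum1_count big_mkcond -big_undup_iterop_count.
  apply: eq_bigr => p _; rewrite Monoid.iteropE iter_addn_0.
  by case: (c < p)%N.
rewrite (big_nth 0%N) big_mkord; apply: eq_bigr => i _.
rewrite -big_distrr /= mulnC; congr muln.
have [ci|ci] := ltnP c (nth 0%N (undup D) i); last first.
  rewrite big1 // => j _; apply/eqP; rewrite eqb0 neq_ltn.
  by rewrite (leq_trans (ltn_ord j) ci).
rewrite (bigD1 (Ordinal (ci : c < level_length i)%N)) //= eqxx big1 // => j.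
by rewrite -val_eqE /= => /negPf ->.
Qed.

End ColumnCount.

Lemma perm_enum_sum (S T : finType) : perm_eq (enum {: S + T})
  ([seq inl x | x <- enum S] ++ [seq inr x | x <- enum T]).
Proof.
apply: uniq_perm; first exact: enum_uniq.
  rewrite cat_uniq; apply/and3P; split.
  - by rewrite map_inj_uniq ?enum_uniq // => x y [].
  - by apply/hasPn => _ /mapP[x _ ->]; apply/mapP => -[].
  - by rewrite map_inj_uniq ?enum_uniq // => x y [].
move=> [x|x]; rewrite mem_enum mem_cat inE; apply/esym/orP.
  by left; apply: map_f; rewrite mem_enum.
by right; apply: map_f; rewrite mem_enum.
Qed.

Lemma map_enum_val (T : finType) : [seq enum_val k | k <- enum 'I_#|T|] = enum T.
Proof.
case: (pickP T) => [x0 _|T0]; last first.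
  have cT : #|T| = 0%N by apply: eq_card0 => x; have := T0 x.
  have s1 : size [seq @enum_val T T k | k <- enum 'I_#|T|] = 0%N.
    by rewrite size_map size_enum_ord cT.
  have s2 : size (enum T) = 0%N by rewrite -cardE.
  by rewrite (size0nil s1) (size0nil s2).
apply: (@eq_from_nth _ x0); first by rewrite size_map size_enum_ord cardE.
move=> i; rewrite size_map size_enum_ord => iT.
rewrite (nth_map (Ordinal iT)) ?size_enum_ord // (enum_val_nth x0).
by rewrite nth_enum_ord.
Qed.

Section CurveOfFrame.
Variables (R : realType) (D : young_diagram) (I : set R).
Hypotheses (hI : is_interval I) (hI2 : exists s t : R, [/\ I s, I t & s < t]).
Variables (W : vectType R) (omega : {skew_symmetric W}) (L : R -> {vspace W}).
Hypothesis dimW : \dim {: W} = (2 * nb_boxes D)%N.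
Variables (e f : box D -> R -> W) (Rt : R -> compatible_mapping R D).
Hypothesis nf : normal_frame I omega L e f Rt.

Let dW : \dim {: W} = (2 * #|box D|)%N. Proof. by rewrite card_box. Qed.

Let sm x : smooth_on I (e x) /\ smooth_on I (f x).
Proof. by case: nf. Qed.

Let darboux t : I t -> symplectic_family omega (e^~ t) (f^~ t).
Proof. by case: nf => _ + _ _ _; apply. Qed.

Let LE t : I t -> L t = <<[seq e x t | x <- enum (box D)]>>%VS.
Proof. by case: nf => _ _ + _ _; apply. Qed.

Let eqs : structure_equations I Rt e f.
Proof. by case: nf => _ _ _ _ /normal_frame_equationsP. Qed.

(** A basis of the i-th extension: f x enters at stage [(box_col x).+1]. *)
Definition extension_seq (i : nat) (t : R) : seq W :=
  [seq e x t | x <- enum (box D)] ++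
  [seq f x t | x <- enum (box D) & (box_col x < i)%N].

Lemma extension_seq_free i t : I t -> free (extension_seq i t).
Proof.
move=> It; apply: (@catl_free _ _ [seq f x t | x <- enum (box D) & ~~ (box_col x < i)%N]).
have := symplectic_family_free (darboux It).
rewrite (perm_free (perm_map _ (perm_enum_sum _ _))) map_cat.
rewrite -[X in X ++ _]map_comp -[X in _ ++ X]map_comp => fr.
rewrite (perm_free (Y := [seq e x t | x <- enum (box D)] ++
  [seq f x t | x <- enum (box D)])) // /extension_seq -catA perm_cat2l -map_cat.
by apply: perm_map; rewrite (perm_filterC (fun x => (box_col x < i)%N)).
Qed.

Lemma dim_extension_seq i t : I t -> \dim <<extension_seq i t>> =
  (#|box D| + \sum_(x : box D | (box_col x < i)%N) 1)%N.
Proof.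
move=> It; rewrite (eqnP (extension_seq_free i It)) size_cat size_map -cardE size_map.
by rewrite size_filter -sum1_count big_enum_cond.
Qed.

Lemma mem_e_span x t : I t -> e x t \in L t.
Proof. by move=> It; rewrite LE //; apply/memv_span/map_f; rewrite mem_enum. Qed.

Lemma omega_e_span x v t : I t -> v \in L t -> omega v (e x t) = 0.
Proof.
move=> It; rewrite LE // => /mem_span_famP[k ->].
rewrite omega_suml big1 // => y _; rewrite omegaZl.
by have [-> _ _] := darboux It y x; rewrite mulr0.
Qed.

Lemma span_isotropic v w t : I t -> v \in L t -> w \in L t -> omega v w = 0.
Proof.
move=> It vL; rewrite LE // => /mem_span_famP[k ->].
by rewrite omega_sumr big1 // => y _; rewrite omegaZr omega_e_span // mulr0.
Qed.

(** Up to sign, [omega v (e x t)] is the coefficient of f x in the expansion of v. *)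
Lemma mem_extension_seq i t v : I t ->
  (forall x, (i <= box_col x)%N -> omega v (e x t) = 0) ->
  v \in <<extension_seq i t>>%VS.
Proof.
move=> It h; rewrite -(symplectic_family_expansion (darboux It) dW v).
apply: memv_suml => x _; apply: memvB; first apply: memvZ.
  by apply: memv_span; rewrite mem_cat map_f // mem_enum.
have [xi|ix] := ltnP (box_col x) i; last first.
  by rewrite omegaC h // oppr0 scale0r mem0v.
by apply/memvZ/memv_span; rewrite mem_cat map_f ?orbT // mem_filter xi mem_enum.
Qed.

Lemma derivative_orthogonal (g : nat -> R -> W) :
  (forall t, I t -> g 0%N t \in L t) ->
  (forall n, has_deriv_on I (g n) (g n.+1)) ->
  forall j t x, I t -> (j <= box_col x)%N -> omega (g j t) (e x t) = 0.
Proof.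
move=> g0 hg; elim=> [|j IH] t x It jx; first by apply: omega_e_span; last exact: g0.
have h := deriv_on_omega (omega := omega) (hg j) (eqs x).1.
have fx : ~~ in_first_column (tag x).
  by rewrite /in_first_column -lt0n; exact: leq_ltn_trans jx.
have colx : box_col (box_left x) = (box_col x).-1 by exact: superbox_col_left.
have h0 : deriv_on I (fun t => omega (g j t) (e x t)) (fun=> 0).
  apply: (eq_deriv_on (@deriv_on_cst _ _ 0)) => // s Is.
  by rewrite IH // ltnW.
have := deriv_on_unique hI hI2 h h0 It; rewrite /frame_de (negPf fx) /=.
rewrite (IH t (box_left x)) ?addr0 // colx -ltnS prednK //.
exact: leq_ltn_trans jx.
Qed.

(* [extension] is a span at a fixed time; these sums of derivatives are
   functions of time, which allows induction by differentiation. *)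
Definition derivative_sum (n : nat) (h : R -> W) : Prop :=
  exists g : nat -> nat -> R -> W,
    (forall j, (forall t, I t -> g j 0%N t \in L t) /\
       forall k, has_deriv_on I (g j k) (g j k.+1)) /\
    forall t, I t -> h t = \sum_(j < n.+1) g j j t.

Lemma derivative_sum_section n h : smooth_on I h ->
  (forall t, I t -> h t \in L t) -> derivative_sum n h.
Proof.
move=> [g [g0 hg]] hL; exists (fun j k t => if j is 0%N then g k t else 0); split.
  move=> [|j]; split=> [t It|k]; rewrite ?mem0v ?g0 ?hL //.
  exact: has_deriv_on0.
by move=> t It; rewrite big_ord_recl /= big1 ?addr0 ?g0.
Qed.

Lemma derivative_sumB n h1 h2 : derivative_sum n h1 -> derivative_sum n h2 ->
  derivative_sum n (fun t => h1 t - h2 t).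
Proof.
move=> [g1 [hg1 E1]] [g2 [hg2 E2]]; exists (fun j k t => g1 j k t - g2 j k t).
split=> [j|t It]; last by rewrite E1 // E2 // sumrB.
have [m1 d1] := hg1 j; have [m2 d2] := hg2 j; split=> [t It|k].
  by rewrite memvB ?m1 ?m2.
exact: (has_deriv_onD (d1 k) (has_deriv_onN (d2 k))).
Qed.

Lemma derivative_sum_deriv n h h' : derivative_sum n h -> has_deriv_on I h h' ->
  derivative_sum n.+1 h'.
Proof.
move=> [g [hg E]] hh; exists (fun j k t => if j is j'.+1 then g j' k t else 0).
split=> [[|j]|t It].
- by split=> [t It|k]; [rewrite mem0v|exact: has_deriv_on0].
- exact: hg.
rewrite big_ord_recl add0r /=.
have hs : has_deriv_on I h (fun t => \sum_(j < n.+1) g j j.+1 t).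
  apply: (eq_has_deriv_on (has_deriv_on_sum (r := index_enum _)
    (fun j : 'I_n.+1 => (hg j).2 j))) => // s Is.
  by rewrite E.
exact: (has_deriv_on_unique hI hI2 hh hs It).
Qed.

(** In the first column f x is the derivative of e x. Further right, with y the left neighbour of x,
    the equation for f y gives f x as a section minus the derivative of f y, at the cost of one more
    derivative per column. *)
Lemma derivative_sum_f x : derivative_sum (box_col x).+1 (f x).
Proof.
move: {2}(box_col x) (erefl (box_col x)) => c; elim: c x => [|c IH] x xc.
  have fx : in_first_column (tag x) by apply/eqP.
  rewrite xc; apply: (@derivative_sum_deriv 0 (e x)).
    by apply: derivative_sum_section => [|t It]; [case: (sm x)|exact: mem_e_span].
  apply: (eq_has_deriv_on (eqs x).1) => // t It.
  by rewrite /frame_de fx.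
have fx : ~~ in_first_column (tag x).
  by rewrite /in_first_column -[superbox_col _]/(box_col x) xc.
have colx : box_col (box_left x) = c.
  by rewrite [LHS]superbox_col_left -[superbox_col _]/(box_col x) xc.
pose y := box_left x.
have sy : ~~ special (tag y).
  apply/negP => sy; have := box_leftK fx; rewrite -/y box_right_special // => yx.
  by have := congr1 (@box_col D) yx; rewrite xc colx => /eqP; rewrite ltn_eqF.
pose ER t := \sum_z mapping_entry (Rt t) y z *: e z t.
have hf' := (eqs y).2; have [_ sf] := sm y.
have fyE t : frame_df (Rt t) (e^~ t) (f^~ t) y = ER t - f x t.
  by rewrite /frame_df (negPf sy) box_leftK.
have dfy := derivative_sum_deriv (IH y colx) hf'.
(* [normal_frame] says nothing about the regularity of [Rt]; smoothness comes from the frame, as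
   [ER] is the derivative of f y plus f x. *)
have sER : smooth_on I ER.
  have [_ sfx] := sm x.
  have := smooth_onD hI hI2 (smooth_on_deriv hI hI2 sf hf') sfx.
  by rewrite (_ : (fun t => _) = ER) //; apply/funext => t; rewrite fyE subrK.
have dER : derivative_sum (box_col x).+1 ER.
  apply: derivative_sum_section => // t It; rewrite LE //.
  by apply/mem_span_famP; exists (mapping_entry (Rt t) y).
have := derivative_sumB dER _; rewrite xc -colx => /(_ _ dfy).
by rewrite (_ : (fun t => _) = f x) //; apply/funext => t; rewrite fyE subKr.
Qed.

(** Derivatives of order at most i are orthogonal to e x in the columns from i on, which gives one
    inclusion; the other holds because f x in a column before i is a sum of such derivatives. *)
Lemma extensionE i t : I t -> extension I L i t = <<extension_seq i t>>%VS.
Proof.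
move=> It; have [h1 h2] := set_spanP [set v | exists l, section I L l /\
     exists g, derivatives_on I l g /\ exists2 j, (j <= i)%N & v = g j t].
apply: subv_anti; apply/andP; split.
  apply: h2 => v [l [[_ lL] [g [[g0 hg] [j ji ->]]]]].
  apply: mem_extension_seq => // x ix.
  apply: derivative_orthogonal (leq_trans ji ix) => // s Is.
  by rewrite g0 // lL.
apply/span_subvP => v; rewrite mem_cat => /orP[/mapP[x _ ->]|].
  apply: h1; exists (e x); split.
    by split=> [|s Is]; [case: (sm x)|exact: mem_e_span].
  have [[g hg] _] := sm x; exists g; split=> //; exists 0%N => //.
  by case: hg => ->.
move=> /mapP[x]; rewrite mem_filter => /andP[xi _] ->.
have [g [hg ->]] := derivative_sum_f x => //.
apply: memv_suml => j _; apply: h1; exists (g j 0%N).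
have [gL dg] := hg j; split.
  by split=> //; exists (g j); split.
by exists (g j); split=> //; exists j => //; apply: leq_trans xi; rewrite -ltnS.
Qed.

Lemma frame_lagrangian_curve : lagrangian_curve I omega L.
Proof.
split.
- move=> t It; split; first by move=> v w; exact: span_isotropic.
  by have := dim_extension_seq 0 It; rewrite /extension_seq (@eq_filter _ _ pred0) //
    filter_pred0 cats0 -LE // dW => ->; rewrite big_pred0 ?addn0.
- move=> t0 It0; exists 1 => //; exists #|box D|, (fun k => e (enum_val k)).
  split=> [k|t [It _]].
    by apply: smooth_on_subset (sm _).1 => s [].
  rewrite (map_comp (e^~ t)) map_enum_val basisEfree LE // subvv /=.
  rewrite dim_span andbT.
  exact: catl_free (extension_seq_free 0 It).
- by move=> i s t Is It; rewrite !extensionE // !dim_extension_seq.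
(* The number of columns of D: from this stage on, every f x belongs to [extension_seq]. *)
- exists (\max_(x : box D) (box_col x).+1)%N => t It; rewrite extensionE //.
  apply/eqP; rewrite eqEdim subvf /= dim_extension_seq // dW.
  rewrite (eq_bigl xpredT) ?sum1_card ?mul2n ?addnn // => x.
  exact: (leq_bigmax x).
Qed.

Lemma frame_has_young_diagram : has_young_diagram D I L.
Proof.
move=> i t It; rewrite !extensionE // !dim_extension_seq // -addnA; congr addn.
rewrite column_sizeE (bigID (fun x => (box_col x < i)%N)) /=; congr addn.
  by apply: eq_bigl => x; lia.
by apply: eq_bigl => x; lia.
Qed.

(** The velocity at v is the sum of the squares of [omega (f x t) v] over the boxes x of the first
    column: differentiating omega(l, e_x) = 0 moves the derivative from the section l to e x, and e
    x' stays in the isotropic space [L t] outside that column. *)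
Lemma frame_nondecreasing : nondecreasing_curve I omega L.
Proof.
move=> t It v q vL [l [g [[sl lL] [g0 hg] lt ->]]].
have gL s : I s -> g 0%N s \in L s by move=> Is; rewrite g0 // lL.
have ole s x : I s -> omega (g 0%N s) (e x s) = 0.
  by move=> Is; apply: omega_e_span => //; exact: gL.
have key x : omega (g 1%N t) (e x t) =
    omega (frame_de (e^~ t) (f^~ t) x) (g 0%N t).
  have h := deriv_on_omega (omega := omega) (hg 0%N) (eqs x).1.
  have h0 : deriv_on I (fun t => omega (g 0%N t) (e x t)) (fun=> 0).
    by apply: (eq_deriv_on (@deriv_on_cst _ _ 0)) => // s Is; rewrite ole.
  have := deriv_on_unique hI hI2 h h0 It.
  by move=> /eqP; rewrite addr_eq0 => /eqP ->; rewrite omegaC opprK.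
rewrite -(g0 t It) -[X in omega _ X](symplectic_family_expansion (darboux It) dW).
rewrite omega_sumr; apply: sumr_ge0 => x _.
rewrite omegaDr omegaNr !omegaZr (_ : omega (e x t) (g 0%N t) = 0); last first.
  by rewrite omegaC ole ?oppr0.
rewrite mul0r subr0 key /frame_de; case: ifP => fx.
  by rewrite -expr2 sqr_ge0.
by rewrite [omega (e _ t) _]omegaC ole // oppr0 mulr0.
Qed.

Lemma frame_monotone_curve : monotone_curve_with_diagram D I omega L.
Proof.
split.
- exact: frame_lagrangian_curve.
- exact: frame_nondecreasing.
- exact: frame_has_young_diagram.
Qed.

End CurveOfFrame.

(** * Comparison of normal frames *)

Section FrameComparison.
Variables (R : realType) (D : young_diagram) (I : set R).
Hypotheses (hI : is_interval I) (hI2 : exists s t : R, [/\ I s, I t & s < t]).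
Variables (W : vectType R) (omega : {skew_symmetric W}).
Hypothesis dimW : \dim {: W} = (2 * nb_boxes D)%N.
Implicit Types (e f : box D -> R -> W) (Rt : R -> compatible_mapping R D).

Lemma structure_equations_symplectic Rt (L1 L2 : R -> {vspace W}) e1 f1 e2 f2 :
  (forall t, I t -> symmetric_mapping (Rt t)) ->
  structure_equations I Rt e1 f1 -> structure_equations I Rt e2 f2 ->
  (forall t, I t -> symplectic_family omega (e1^~ t) (f1^~ t)) ->
  (forall t, I t -> symplectic_family omega (e2^~ t) (f2^~ t)) ->
  (forall t, I t -> L1 t = <<[seq e1 x t | x <- enum (box D)]>>%VS) ->
  (forall t, I t -> L2 t = <<[seq e2 x t | x <- enum (box D)]>>%VS) ->
  exists S : 'End(W), isometry omega omega S /\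
    forall t, I t -> L2 t = (S @: L1 t)%VS.
Proof.
move=> sR h1 h2 d1 d2 hL1 hL2; have [t0 [_ [It0 _ _]]] := hI2.
have dW : \dim {: W} = (2 * #|box D|)%N by rewrite card_box.
pose S0 := expansion omega (e1^~ t0) (f1^~ t0) (e2^~ t0) (f2^~ t0).
have S0lin : linear S0.
  move=> a u v; rewrite /S0 /expansion scaler_sumr -big_split.
  apply: eq_bigr => x _ /=.
  by rewrite !omegaDr !omegaZr !scalerDl scalerBr !scalerA opprD addrACA.
pose S1 : {linear W -> W} := HB.pack S0 (GRing.isLinear.Build _ _ _ _ S0 S0lin).
exists (linfun S1); split=> [u v|t It].
  rewrite !lfunE /= -[in RHS](symplectic_family_expansion (d1 t0 It0) dW u).
  (* S0 preserves coordinates from one Darboux basis to the other, hence it preserves [omega]. *)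
  have coef w x : omega (f2 x t0) (S0 w) = omega (f1 x t0) w /\
      omega (e2 x t0) (S0 w) = omega (e1 x t0) w.
    have := symplectic_family_coef (fun x => omega (f1 x t0) w)
      (fun x => - omega (e1 x t0) w) (d2 t0 It0).
    rewrite /S0 /expansion; under eq_bigr do rewrite scaleNr.
    by move=> /(_ x)[-> ->]; rewrite opprK.
  rewrite {1}/S0 !omega_suml; apply: eq_bigr => x _.
  have [E1 E2] := coef v x.
  by rewrite !omegaDl !omegaNl !omegaZl E1 E2.
(* By constancy the map is also the expansion at time t, where the Darboux relations evaluate it on
   e1 x t. *)
have SE x : linfun S1 (e1 x t) = e2 x t.
  rewrite lfunE /= /S0 (expansion_constant hI omega (e1 x t) sR h1 h2 It0 It).
  rewrite /expansion (bigD1 x) //= big1 ?addr0.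
    by have [-> _ ->] := d1 t It x x; rewrite eqxx scale1r scale0r subr0.
  move=> y yx; have [-> _ ->] := d1 t It y x.
  by rewrite (negPf yx) !scale0r subr0.
rewrite hL1 // hL2 // limg_span; congr <<_>>%VS; rewrite -[RHS]map_comp.
by apply: eq_map => x /=; rewrite SE.
Qed.

(** * Rotation of a frame by constant orthogonal matrices *)

Section Rotation.
Variable U : forall i : level D, 'M[R]_(level_mult i).
Hypothesis UU : forall i, (U i)^T *m U i = 1%:M.

(** The row of vectors of a superbox, multiplied on the right by the matrix of its level. *)
Definition rotate (g : box D -> R -> W) (x : box D) (t : R) : W :=
  \sum_m U (tag (tag x)) m (tagged x) *: g (@mkbox D (tag x) m) t.

Lemma rotate_deriv g g' : (forall x, has_deriv_on I (g x) (g' x)) ->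
  forall x, has_deriv_on I (rotate g x) (rotate g' x).
Proof.
move=> h x; apply: has_deriv_on_sum => m.
apply: (eq_has_deriv_on (has_deriv_onZ (@deriv_on_cst _ _ _) (h _))) => // t _.
by rewrite scale0r add0r.
Qed.

Lemma omega_rotate g1 g2 t x y : omega (rotate g1 x t) (rotate g2 y t) =
  \sum_m \sum_n U (tag (tag x)) m (tagged x) * U (tag (tag y)) n (tagged y) *
    omega (g1 (@mkbox D (tag x) m) t) (g2 (@mkbox D (tag y) n) t).
Proof.
rewrite omega_suml; apply: eq_bigr => m _; rewrite omega_sumr.
by apply: eq_bigr => n _; rewrite omegaZl omegaZr mulrA.
Qed.

Lemma rotate_symplectic e f t : symplectic_family omega (e^~ t) (f^~ t) ->
  symplectic_family omega ((rotate e)^~ t) ((rotate f)^~ t).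
Proof.
move=> h x y; rewrite !omega_rotate; split.
- rewrite big1 // => m _; rewrite big1 // => n _.
  by have [-> _ _] := h (@mkbox D (tag x) m) (@mkbox D (tag y) n); rewrite mulr0.
- rewrite big1 // => m _; rewrite big1 // => n _.
  by have [_ -> _] := h (@mkbox D (tag x) m) (@mkbox D (tag y) n); rewrite mulr0.
have E m n : omega (f (@mkbox D (tag x) m) t) (e (@mkbox D (tag y) n) t) =
    (@mkbox D (tag x) m == @mkbox D (tag y) n)%:R.
  by have [_ _ E] := h (@mkbox D (tag x) m) (@mkbox D (tag y) n).
under eq_bigr do under eq_bigr do rewrite E.
case: x y {E} => [a k] [b l] /=; have [ab|ab] := eqVneq a b; last first.
  have ne m n : (@mkbox D a m == @mkbox D b n) = false.
    by apply/negbTE; apply: contra ab => /eqP/(congr1 tag) /= ->.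
  rewrite big1 => [|m _]; last by rewrite big1 // => n _; rewrite ne mulr0.
  by rewrite (ne k l).
subst b.
have eqE m n : (@mkbox D a m == @mkbox D a n) = (m == n) by rewrite eq_Tagged.
have := congr1 (fun M : 'M[R]_(_, _) => M k l) (UU (tag a)).
rewrite !mxE -[RHS]/((k == l)%:R) => UUkl.
rewrite (eqE k l) -UUkl.
apply: eq_bigr => m _; rewrite (bigD1 m) //= eqE eqxx mulr1 mxE big1 ?addr0 //.
by move=> n nm; rewrite eqE eq_sym (negPf nm) mulr0.
Qed.

(** Shifts preserve the level, so they commute with the rotation. For the curvature terms, E_b
    R2(a,b) U_a = (E_b U_b) R1(a,b) is the intertwining relation. *)
Lemma rotate_structure_equations Rt1 Rt2 e f :
  (forall t, I t -> forall a b : superbox D,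
     U (tag b) *m Rt1 t a b = Rt2 t a b *m U (tag a)) ->
  structure_equations I Rt2 e f ->
  structure_equations I Rt1 (rotate e) (rotate f).
Proof.
move=> UR h x; split.
  have h1 := @rotate_deriv e _ (fun x => (h x).1) x.
  apply: (eq_has_deriv_on h1) => // t It.
  by rewrite /frame_de /rotate /=; case: ifP.
have h2 := @rotate_deriv f _ (fun x => (h x).2) x.
apply: (eq_has_deriv_on h2) => // t It.
rewrite /frame_df {1}/rotate /=.
under eq_bigr do rewrite scalerBr; rewrite sumrB; congr (_ - _); last first.
  case: ifP => // _; rewrite big1 // => m _; exact: scaler0.
case: x {h2} => a k /=.
under eq_bigr do rewrite scaler_sumr.
rewrite exchange_big /=.
transitivity (\sum_(b : superbox D) \sum_(n < superbox_size b)
    \sum_(m < superbox_size a)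
      U (tag a) m k *: (Rt2 t a b n m *: e (mkbox n) t)).
  rewrite (sum_box (fun b n => \sum_(m < superbox_size a)
    U (tag a) m k *: (Rt2 t a b n m *: e (mkbox n) t))).
  by apply: eq_bigr => -[].
transitivity (\sum_(b : superbox D) \sum_(n < superbox_size b)
    Rt1 t a b n k *: rotate e (mkbox n) t); last first.
  rewrite (sum_box (fun b n => Rt1 t a b n k *: rotate e (mkbox n) t)).
  by apply: eq_bigr => -[].
apply: eq_bigr => b _; rewrite [RHS](eq_bigr (fun n => \sum_p
   (U (tag b) p n * Rt1 t a b n k) *: e (@mkbox D b p) t)) => [|n _]; last first.
  by rewrite scaler_sumr; apply: eq_bigr => p _; rewrite scalerA mulrC.
rewrite [RHS]exchange_big; apply: eq_bigr => n _ /=.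
rewrite -scaler_suml; under eq_bigr do rewrite scalerA.
rewrite -scaler_suml; congr (_ *: _).
have := congr1 (fun M : 'M[R]_(_, _) => M n k)
  (UR t It a b).
by rewrite !mxE => ->; apply: eq_bigr => m _; rewrite mulrC.
Qed.

Lemma rotate_span e f t : symplectic_family omega (e^~ t) (f^~ t) ->
  <<[seq e x t | x <- enum (box D)]>>%VS =
  <<[seq rotate e x t | x <- enum (box D)]>>%VS.
Proof.
move=> h; apply/esym/eqP; rewrite eqEdim; apply/andP; split.
  apply/span_subvP => _ /mapP[x _ ->]; apply: memv_suml => m _.
  by apply/memvZ/memv_span/map_f; rewrite mem_enum.
have fr := symplectic_family_freel (rotate_symplectic h).
rewrite (eqnP fr) (eqnP (symplectic_family_freel h)).
by rewrite size_map [in leqRHS]size_map.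
Qed.

End Rotation.

Lemma curves_symplectic L1 L2 e1 f1 Rt1 e2 f2 Rt2
    (U : forall i : level D, 'M[R]_(level_mult i)) :
  normal_frame I omega L1 e1 f1 Rt1 -> normal_frame I omega L2 e2 f2 Rt2 ->
  (forall i, (U i)^T *m U i = 1%:M) ->
  (forall t, I t -> forall a b : superbox D,
     U (tag b) *m Rt1 t a b = Rt2 t a b *m U (tag a)) ->
  exists S : 'End(W), isometry omega omega S /\
    forall t, I t -> L2 t = (S @: L1 t)%VS.
Proof.
move=> [_ d1 hL1 n1 /normal_frame_equationsP s1].
move=> [_ d2 hL2 n2 /normal_frame_equationsP s2] UU UR.
apply: (structure_equations_symplectic _ s1 (rotate_structure_equations UR s2) d1).
- by move=> t It; have [[]] := n1 t It.
- by move=> t It; apply: rotate_symplectic => //; exact: d2.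
- exact: hL1.
- by move=> t It; rewrite hL2 //; apply: rotate_span => //; exact: d2.
Qed.

End FrameComparison.

(** * Quivers of curvatures *)

Section Essential.
Variables (R : realType) (D : young_diagram).
Implicit Types (Rm : compatible_mapping R D).

Lemma essential_sym (a b : superbox D) : essential R a b -> essential R b a.
Proof.
move=> [Rm nR Rab]; exists Rm => //; have [[sR _ _] _] := nR.
by rewrite sR => /(congr1 trmx); rewrite trmxK trmx0.
Qed.

(** Apart from symmetry and antisymmetry, normality only restricts the pairs where a mapping may be
    nonzero. An essential pair satisfies these restrictions because some normal mapping is nonzero
    there. *)
Lemma normal_mapping_support Rm : symmetric_mapping Rm ->
  (forall a b, Rm a b <> 0 -> essential R a b) ->
  (forall a, ~~ special a ->
    (Rm a (superbox_right a))^T = - Rm a (superbox_right a) :> 'M[R]_(superbox_size a)) ->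
  normal_mapping Rm.
Proof.
move=> sR ess anti; split.
  split=> // a b ab /ess[Rn [[_ + _] _] Rnab]; exact.
move=> j i ji a b abin; have [//|ne] := pselect (Rm a b = 0).
have [Rn [_ Rn0] Rnab] := ess a b ne.
by case: Rnab; exact: Rn0 abin.
Qed.

Lemma normal_mapping_nonessential Rm a b : normal_mapping Rm ->
  ~ essential R a b -> Rm a b = 0.
Proof.
move=> nR ne; have [//|Rab] := pselect (Rm a b = 0).
by case: ne; exists Rm.
Qed.

End Essential.

Section QuiverOfFrame.
Variables (R : realType) (D : young_diagram) (I : set R).
Variables (W : vectType R) (omega : {skew_symmetric W}) (L : R -> {vspace W}).
Variables (e f : box D -> R -> W) (Rt : R -> compatible_mapping R D).
Hypothesis nf : normal_frame I omega L e f Rt.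

Lemma from_modelK t a : I t -> cancel (@from_model R D W e t a) (to_model e t a).
Proof.
move=> It y; have [_ /(_ t It) d _ _ _] := nf.
have fr : free (frame_part e t a).
  apply/freeP => k k0 i.
  have [_ _ fe] := d (mkbox i) (mkbox i).
  have : omega (f (mkbox i) t) (\sum_j k j *: (frame_part e t a)`_j) = k i.
    rewrite omega_sumr (bigD1 i) //= omegaZr /frame_part nth_mktuple fe eqxx mulr1.
    rewrite big1 ?addr0 // => j ji; rewrite omegaZr /frame_part nth_mktuple.
    have [_ _ ->] := d (mkbox i) (mkbox j).
    by rewrite eq_Tagged /= eq_sym (negPf ji) mulr0.
  by rewrite k0 omega0r => <-.
apply/matrixP => i j; rewrite ord1 mxE /from_model.
under eq_bigr do rewrite (tnth_nth 0).
exact: coord_sum_free.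
Qed.

Lemma frame_curvature_quiverE t (x : arrow (diagram_quiver R D))
    (y : 'cV[R]_(superbox_size (ep_source x))) : I t ->
  rep_map (frame_curvature_quiver e Rt) t x y =
  Rt t (ep_source x) (ep_target x) *m y.
Proof.
(* [linfun] evaluates to its argument only if that is linear, which shows once the composite is
   recognised as a matrix product. *)
move=> It /=; have -> : (fun y : 'cV[R]_(superbox_size (ep_source x)) =>
    to_model e t (ep_target x)
      (curvature_mapping e Rt t (ep_source x) (ep_target x) (from_model e t y))) =
    mulmx (Rt t (ep_source x) (ep_target x)).
  by apply/funext => z; rewrite /curvature_mapping !from_modelK.
by rewrite lfunE.
Qed.

End QuiverOfFrame.

Section Existence.
Variables (R : realType) (D : young_diagram) (I : set R).
Hypotheses (hI : is_interval I) (hI2 : exists s t : R, [/\ I s, I t & s < t]).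

Lemma smooth_on_scalar (V : vectType R) (phi : V -> R) (F : R -> V) :
  scalar phi -> smooth_on I F -> smooth_on I ((fun t => phi (F t)) : R -> R^o).
Proof.
move=> hphi; pose psi : {linear V -> R^o} := HB.pack (phi : V -> R^o)
  (GRing.isLinear.Build _ _ _ _ (phi : V -> R^o) hphi).
exact: (smooth_on_linear hI hI2 psi).
Qed.

(** * The normal mappings of a representation in orthonormal bases *)

Section Representation.
Variable Xi : rep_family R (diagram_quiver R D).
Hypothesis cXi : compatible_rep_family I Xi.
Variable b : forall i : level D, 'I_(level_mult i) -> rep_space Xi i.
Hypothesis hb : forall i k l,
  inner (rep_space Xi i) (b k) (b l) = (k == l)%:R.

Definition rep_mapping (t : R) : compatible_mapping R D := fun u v =>
  match pselect (essential R u v) with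
  | left h => \matrix_(n, m) inner (rep_space Xi (tag v))
                (pair_map Xi t h (@b (tag u) m)) (@b (tag v) n)
  | right _ => 0
  end.

(** Arrows carry a proof that their pair is essential; by proof irrelevance any such proof may be
    used. *)
Lemma rep_mappingE t u v (h : essential R u v) n m : rep_mapping t u v n m =
  inner (rep_space Xi (tag v)) (pair_map Xi t h (@b (tag u) m)) (@b (tag v) n).
Proof.
rewrite /rep_mapping; case: pselect => // h'; rewrite mxE.
by rewrite (Prop_irrelevance h' h).
Qed.

Lemma rep_mapping0 t u v : ~ essential R u v -> rep_mapping t u v = 0.
Proof. by rewrite /rep_mapping; case: pselect. Qed.

Lemma inner_sym (V : euclidean_space R) (x y : V) : inner V x y = inner V y x.
Proof. by rewrite hermC expr0 mul1r. Qed.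

Lemma rep_mapping_normal t : I t -> normal_mapping (rep_mapping t).
Proof.
move=> It; have [_ c2 c3] := cXi; apply: normal_mapping_support.
- move=> u v; have [h|h] := pselect (essential R u v); last first.
    by rewrite !rep_mapping0 ?trmx0 // => /essential_sym.
  apply/matrixP => m n; rewrite mxE (rep_mappingE _ h) (rep_mappingE _ (essential_sym h)).
  by rewrite (c2 t It u v h (essential_sym h)) inner_sym.
- move=> u v; have [//|h] := pselect (essential R u v).
  by rewrite rep_mapping0.
- move=> u su; have [h|h] := pselect (essential R u (superbox_right u)); last first.
    by rewrite rep_mapping0 // trmx0 oppr0.
  apply/matrixP => m n; rewrite mxE [RHS]mxE !(rep_mappingE _ h).
  by rewrite [LHS](c3 t It u h su) inner_sym.
Qed.

Lemma rep_mapping_smooth x y :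
  (forall x : arrow (diagram_quiver R D), smooth_on I (fun t => rep_map Xi t x)) ->
  smooth_on I ((fun t => mapping_entry (rep_mapping t) x y) : R -> R^o).
Proof.
move=> sXi; have [h|h] := pselect (essential R (tag x) (tag y)); last first.
  rewrite (_ : (fun t => _) = fun=> 0); first exact: smooth_on0.
  by apply/funext => t; rewrite /mapping_entry rep_mapping0 // mxE.
rewrite (_ : (fun t => _) = fun t => inner (rep_space Xi (tag (tag y)))
  (rep_map Xi t (EssentialPair h : arrow (diagram_quiver R D))
     (@b (tag (tag x)) (tagged x)))
  (@b (tag (tag y)) (tagged y))); last first.
  by apply/funext => t; rewrite /mapping_entry (rep_mappingE _ h).
(* An entry is a fixed linear functional of the map on the arrow, so it inherits smoothness. *)
pose phi (g : 'Hom(rep_space Xi (tag (tag x)), rep_space Xi (tag (tag y)))) : R :=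
  inner (rep_space Xi (tag (tag y))) (g (@b (tag (tag x)) (tagged x)))
    (@b (tag (tag y)) (tagged y)).
apply: (smooth_on_scalar (phi := phi)) (sXi (EssentialPair h)) => a g1 g2.
rewrite /phi.
by rewrite add_lfunE scale_lfunE linearDl linearZl_LR.
Qed.

Definition rep_iso (i : level D) (y : 'cV[R]_(level_mult i)) : rep_space Xi i :=
  \sum_k y k 0 *: b k.

Lemma rep_iso_linear i : linear (@rep_iso i).
Proof.
move=> a y z; rewrite /rep_iso scaler_sumr -big_split; apply: eq_bigr => k _.
by rewrite !mxE scalerDl scalerA.
Qed.

HB.instance Definition _ i := GRing.isLinear.Build _ _ _ _ (@rep_iso i)
  (@rep_iso_linear i).

Lemma inner_rep_iso i (y : 'cV[R]_(level_mult i)) k :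
  inner (rep_space Xi i) (rep_iso y) (b k) = y k 0.
Proof.
rewrite /rep_iso linear_sumlz (bigD1 k) //= linearZl_LR /= hb eqxx mulr1.
by rewrite big1 ?addr0 // => j jk; rewrite linearZl_LR /= hb (negPf jk) mulr0.
Qed.

Lemma rep_isoP i : isometry (inner (rep_space Xi i))
  (inner (std_euclidean R (level_mult i))) (linfun (@rep_iso i)) /\
  bijective (linfun (@rep_iso i)).
Proof.
split=> [y z|].
  rewrite !lfunE /= {2}/rep_iso linear_sumr; apply: eq_bigr => k _.
  by rewrite linearZ /= inner_rep_iso mulrC.
exists (fun v => \col_k inner (rep_space Xi i) v (b k)) => [y|v].
  by apply/matrixP => k j; rewrite ord1 mxE lfunE /= inner_rep_iso.
have [c1 _ _] := cXi; rewrite lfunE /= [RHS](orthonormal_expansion (c1 i) (@hb i)).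
by apply: eq_bigr => k _; rewrite mxE.
Qed.

Lemma rep_iso_mapping t u v (h : essential R u v) (y : 'cV[R]_(level_mult (tag u))) :
  rep_iso (rep_mapping t u v *m y : 'cV[R]_(level_mult (tag v))) =
  pair_map Xi t h (rep_iso y).
Proof.
have [c1 _ _] := cXi.
rewrite [RHS](orthonormal_expansion (c1 _) (@hb _)); apply: eq_bigr => n _.
congr (_ *: _); rewrite mxE [in RHS]/rep_iso linear_sum linear_sumlz.
apply: eq_bigr => m _; rewrite linearZ linearZl_LR /= (rep_mappingE _ h).
by rewrite mulrC.
Qed.

End Representation.
End Existence.

Section Uniqueness.
Variables (R : realType) (D : young_diagram) (I : set R).
Variables (W : vectType R) (omega : {skew_symmetric W}).

(** U is the matrix of phi1 followed by the inverse of phi2. It is orthogonal because both are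
    isometries, and it intertwines the two mappings on arrows because both commute with [Xi]; on the
    other pairs both mappings vanish. *)
Lemma quiver_iso_intertwiner (Xi : rep_family R (diagram_quiver R D))
    (L1 L2 : R -> {vspace W}) e1 f1 Rt1 e2 f2 Rt2 :
  normal_frame I omega L1 e1 f1 Rt1 -> normal_frame I omega L2 e2 f2 Rt2 ->
  iso_rep_family I (frame_curvature_quiver e1 Rt1) Xi ->
  iso_rep_family I (frame_curvature_quiver e2 Rt2) Xi ->
  exists U : forall i : level D, 'M[R]_(level_mult i),
    (forall i, (U i)^T *m U i = 1%:M) /\
    forall t, I t -> forall a b : superbox D,
      U (tag b) *m Rt1 t a b = Rt2 t a b *m U (tag a).
Proof.
move=> nf1 nf2 [phi1 [iso1 comm1]] [phi2 [iso2 comm2]].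
pose psi (i : level D) (y : 'cV[R]_(level_mult i)) : 'cV[R]_(level_mult i) :=
  ((phi2 i)^-1)%VF (phi1 i y).
have phi2K i y : phi2 i (psi i y) = phi1 i y.
  apply: limg_lfunVK; have [_ [g _ gK]] := iso2 i.
  by rewrite -(gK (phi1 i y)); apply: memv_img; exact: memvf.
pose U (i : level D) : 'M[R]_(level_mult i) :=
  \matrix_(m, k) psi i (delta_mx k 0) m 0.
have UE i (y : 'cV[R]_(level_mult i)) : U i *m y = psi i y.
  have -> : y = \sum_k y k 0 *: delta_mx k 0.
    by rewrite [LHS]matrix_sum_delta; apply: eq_bigr => k _; rewrite big_ord1.
  rewrite mulmx_sumr /psi !linear_sum; apply: eq_bigr => k _.
  rewrite -scalemxAr !linearZ; congr (_ *: _).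
  by rewrite -colE; apply/matrixP => m j; rewrite ord1 !mxE.
exists U; split=> [i|t It a b].
  apply/matrixP => k n; rewrite mxE.
  have [is1 _] := iso1 i; have [is2 _] := iso2 i.
  have E : std_inner (psi i (delta_mx k 0)) (psi i (delta_mx n 0)) =
      std_inner (delta_mx k 0 : 'cV[R]_(level_mult i)) (delta_mx n 0).
    rewrite -[LHS](is2 (psi i (delta_mx k 0)) (psi i (delta_mx n 0))) !phi2K.
    exact: is1.
  transitivity (std_inner (psi i (delta_mx k 0)) (psi i (delta_mx n 0))).
    by apply: eq_bigr => m _; rewrite !mxE.
  rewrite E /std_inner (bigD1 k) //= !mxE !eqxx mul1r andbT big1 ?addr0 //.
  by move=> m mk; rewrite !mxE (negPf mk) mul0r.
have [h|h] := pselect (essential R a b); last first.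
  have [_ _ _ n1 _] := nf1; have [_ _ _ n2 _] := nf2.
  by rewrite !(normal_mapping_nonessential _ h) ?mulmx0 ?mul0mx; auto.
have key (y : 'cV[R]_(level_mult (tag a))) :
    U (tag b) *m (Rt1 t a b *m y) = Rt2 t a b *m (U (tag a) *m y).
  have [_ bij2] := iso2 (tag b); apply: (bij_inj bij2).
  have c1 := comm1 t It (EssentialPair h : arrow (diagram_quiver R D)) y.
  have c2 := comm2 t It (EssentialPair h : arrow (diagram_quiver R D))
    (U (tag a) *m y).
  rewrite (frame_curvature_quiverE nf1) // in c1.
  rewrite (frame_curvature_quiverE nf2) // in c2.
  rewrite [LHS](congr1 (phi2 (tag b)) (UE (tag b) _)) phi2K.
  apply: (etrans c1); apply: esym; apply: (etrans c2); congr (rep_map Xi t _ _).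
  by rewrite [in LHS](UE (tag a) y); exact: phi2K.
apply/matrixP => m k.
have := congr1 (fun M : 'cV[R]_(level_mult (tag b)) => M m 0) (key (delta_mx k 0)).
by rewrite !mulmxA -!colE !mxE.
Qed.

End Uniqueness.

Lemma antisymmetric_mx1 (R : realType) n (A : 'M[R]_n) :
  n = 1%N -> A^T = - A -> A = 0.
Proof.
move=> n1 AT; subst n; apply/matrixP => i j; rewrite !ord1 !mxE.
by have := congr1 (fun M : 'M[R]_1 => M 0 0) AT; rewrite !mxE; lra.
Qed.

Theorem theorem2 (R : realType) (D : young_diagram)
    (I : set R) (hI : is_interval I)
    (hI2 : exists s t : R, [/\ I s, I t & s < t])
    (W : vectType R) (omega : {skew_symmetric W})
    (homega : nondegenerate omega)
    (dimW : \dim {: W} = (2 * nb_boxes D)%N) :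
  (forall Xi : rep_family R (diagram_quiver R D),
     compatible_rep_family I Xi ->
     (forall x : arrow (diagram_quiver R D),
        smooth_on I (fun t => rep_map Xi t x)) ->
     exists_unique_up_to_symplectic I omega (fun L =>
       monotone_curve_with_diagram D I omega L /\
       exists2 X, curvature_quiver_of I omega L X & iso_rep_family I X Xi))
  /\
  (uniq D ->
   forall rho : superbox D -> superbox D -> R -> R,
     (forall a b, essential R a b ->
        smooth_on I (rho a b : R -> R^o) /\
        forall t, I t -> rho a b t = rho b a t) ->
     exists_unique_up_to_symplectic I omega (fun L =>
       monotone_curve_with_diagram D I omega L /\
       exists e f Rt, normal_frame I omega L e f Rt /\
         forall a b, essential R a b ->
           forall t, I t -> Rt t a b = const_mx (rho a b t))).
Proof.
split=> [Xi cXi sXi|uD rho hrho]; split.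
- have [c1 _ _] := cXi.
  have H (i : level D) : exists b : 'I_(level_mult i) -> rep_space Xi i,
      forall k l, inner (rep_space Xi i) (b k) (b l) = (k == l)%:R.
    by apply: orthonormal_family_exists; rewrite c1.
  pose b i := sval (cid (H i)).
  have hb (i : level D) k l :
      inner (rep_space Xi i) (b i k) (b i l) = (k == l)%:R.
    exact: svalP (cid (H i)) k l.
  pose Rt t := rep_mapping b t.
  have [e [f nf]] := normal_frame_exists hI hI2 homega dimW
    (fun t It => rep_mapping_normal cXi b It)
    (fun x y => rep_mapping_smooth hI hI2 b x y sXi).
  exists (fun t => <<[seq e x t | x <- enum (box D)]>>%VS); split.
    exact: (frame_monotone_curve hI hI2 dimW nf).
  exists (frame_curvature_quiver e Rt); first by exists e, f, Rt.
  exists (fun i => linfun (@rep_iso R D Xi b i)); split=> [i|t It [u v h] y].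
    exact: (rep_isoP cXi hb i).
  rewrite (frame_curvature_quiverE nf) // !lfunE /=.
  exact: (rep_iso_mapping cXi hb).
- move=> L1 L2 [_ [_ [e1 [f1 [Rt1 [nf1 ->]]]] iso1]]
    [_ [_ [e2 [f2 [Rt2 [nf2 ->]]]] iso2]].
  have [U [UU UR]] := quiver_iso_intertwiner nf1 nf2 iso1 iso2.
  exact: (curves_symplectic hI hI2 dimW nf1 nf2 UU UR).
- have mult1 (i : level D) : level_mult i = 1%N.
    rewrite /level_mult count_uniq_mem // -mem_undup.
    by rewrite mem_nth.
  pose Rt (t : R) : compatible_mapping R D := fun a b =>
    if pselect (essential R a b) then const_mx (rho a b t) else 0.
  have nR t : I t -> normal_mapping (Rt t).
    move=> It; apply: normal_mapping_support => [a b|a b|a sa].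
    - rewrite /Rt; case: pselect => h; case: pselect => h'.
      + by apply/matrixP => i j; rewrite !mxE (hrho _ _ h).2.
      + by case: h'; exact: essential_sym.
      + by case: h; exact: essential_sym.
      + by rewrite trmx0.
    - by rewrite /Rt; case: pselect.
    - rewrite /Rt; case: pselect => h; last by rewrite trmx0 oppr0.
      (* Here (a, r(a)) cannot be essential: its matrices are antisymmetric of size 1, hence
         zero. *)
      have [Rn [[_ _ anti] _] []] := h.
      exact: (antisymmetric_mx1 (mult1 (tag a)) (anti a sa)).
  have sR x y : smooth_on I ((fun t => mapping_entry (Rt t) x y) : R -> R^o).
    rewrite /mapping_entry /Rt; case: pselect => h.
      have [srho _] := hrho _ _ h; apply: (eq_smooth_on srho) => t It.
      by rewrite mxE.
    apply: (eq_smooth_on (smooth_on0 hI hI2 R^o)) => t It.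
    by rewrite mxE.
  have [e [f nf]] := normal_frame_exists hI hI2 homega dimW nR sR.
  exists (fun t => <<[seq e x t | x <- enum (box D)]>>%VS); split.
    exact: (frame_monotone_curve hI hI2 dimW nf).
  exists e, f, Rt; split=> // a b h t It.
  by rewrite /Rt; case: pselect.
- move=> L1 L2 [_ [e1 [f1 [Rt1 [nf1 E1]]]]] [_ [e2 [f2 [Rt2 [nf2 E2]]]]].
  (* The two mappings both equal [rho] on essential pairs and vanish elsewhere, so the frames
     already satisfy the same equations. *)
  apply: (curves_symplectic hI hI2 dimW (U := fun=> 1%:M) nf1 nf2) => [i|t It a b].
    by rewrite trmx1 mulmx1.
  rewrite mul1mx mulmx1; have [h|h] := pselect (essential R a b).
    by rewrite E1 // E2.
  have [_ _ _ n1 _] := nf1; have [_ _ _ n2 _] := nf2.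
  by rewrite !(normal_mapping_nonessential _ h); auto.
Qed.
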